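(* Let $p$ be a prime number, let $m,\ell$ be positive integers with $\ell\mid m$ such that $m_\ell=\frac m\ell$ is even, let $\alpha$ be a primitive element of $\mathbb{F}_{p^m}$ and let $\gamma=\alpha^t\in\mathbb{F}_{p^m}$. For $\beta\in\mathbb{F}_{p^m}$ consider the curve $C_{\gamma,\beta}:\ y^p-y=\gamma x^{p^\ell+1}+\beta x$ over $\mathbb{F}_{p^m}$. (a) Let $p$ be odd. Then $C_{\gamma,\beta}$ is (i) minimal for $p^{m-2\ell-1}-(p-1)p^{\frac m2-\ell-1}$ elements $\beta\in\mathbb{F}_{p^m}$, if $\frac12m_\ell$ is even and $t\equiv0\pmod{p^\ell+1}$; (ii) maximal for $p^{m-2\ell-1}+(p-1)p^{\frac m2-\ell-1}$ elements $\beta\in\mathbb{F}_{p^m}$, if $\frac12m_\ell$ is odd and $t\equiv\frac{p^\ell+1}{2}\pmod{p^\ell+1}$. (b) Let $p=2$ and $\gamma\in S_{2,m}(\ell)=\{x^{2^\ell+1}:x\in\mathbb{F}_{2^m}^*\}$. Then (i) there are $2^{m-2\ell-1}-2^{\frac m2-\ell-1}$ elements $\beta\in\mathbb{F}_{2^m}$ such that $C_{\gamma,\beta}$ is minimal, and (ii) there are $2^{m-2\ell-1}+2^{\frac m2-\ell-1}$ elements $\beta\in\mathbb{F}_{2^m}$ such that $C_{\gamma,\beta}$ is maximal.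
   Context: $C_{\gamma,\beta}$ denotes the smooth projective model of the affine curve (with one point at infinity). A curve $C$ of genus $g$ over $\mathbb{F}_{p^m}$ is maximal (resp. minimal) if $\#C(\mathbb{F}_{p^m})=p^m+1+2g\,p^{m/2}$ (resp. $p^m+1-2g\,p^{m/2}$), i.e. it attains the upper (resp. lower) Hasse–Weil bound. *)

(* Defs.v *)
From HB Require Import structures.
From mathcomp Require Import all_boot all_order all_algebra.
From mathcomp Require Import boolp classical_sets cardinality.

Set Implicit Arguments.
Unset Strict Implicit.
Unset Printing Implicit Defensive.

Import Order.TTheory GRing.Theory Num.Theory.
Local Open Scope ring_scope.

(* The smooth projective model of an affine plane curve h(x, y) = 0, with h in
   K[x][y] monic of positive degree in y, irreducible, and K perfect.  It is
   the normalization of the projective x-line in the function field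
   K(x)[y]/(h), glued from two affine charts: the spectra of the integral
   closures of K[x] and of K[1/x], whose overlap is the locus x != 0 of the
   first chart. *)
Section SmoothModel.

Variables (K : fieldType) (h : {poly {poly K}}).

Definition ratfun_const (c : K) : {fraction {poly K}} := FracField.tofrac c%:P.

Definition ratfun_x : {fraction {poly K}} := FracField.tofrac 'X.

(* {poly %/ _} is a ring for every h; it is a field when h is irreducible. *)
Definition fun_field :=
  {poly %/ map_poly (@FracField.tofrac {poly K}) h}.

Definition of_ratfun (s : {fraction {poly K}}) : fun_field := s *: 1.

Definition of_const (c : K) : fun_field := of_ratfun (ratfun_const c).

(* The integral closure in the function field of the subring K[s] of K(x). *)
Definition chart (s : {fraction {poly K}}) : set fun_field :=
  fun z => integralOver
             (fun a : {poly K} => of_ratfun (map_poly ratfun_const a).[s]) z.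

Definition chart_fin : set fun_field := chart ratfun_x.

Definition chart_inf : set fun_field := chart ratfun_x^-1.

(* The localization of [chart_fin] at x. *)
Definition overlap : set fun_field :=
  fun z => exists n : nat, chart_fin (of_ratfun ratfun_x ^+ n * z).

(* The rational points of Spec B, as the ideals M of B for which the structure
   map K -> B / M is bijective. *)
Definition rational_point (B M : set fun_field) : Prop :=
  [/\ forall z, M z -> B z,
      M 0,
      forall u v, M u -> M v -> M (u + v),
      forall b u, B b -> M u -> M (b * u)
    & forall b, B b -> exists! c : K, M (b - of_const c)].

(* The points of the projective model outside the finite chart are the points
   of the other chart at which 1/x vanishes. *)
Definition num_points (N : nat) : Prop :=
  exists n_fin n_inf : nat,
    [/\ card_eq (fun M => rational_point chart_fin M) (fun k => (k < n_fin)%N),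
        card_eq (fun M => rational_point chart_inf M
                          /\ M (of_ratfun ratfun_x^-1))
                (fun k => (k < n_inf)%N)
      & N = (n_fin + n_inf)%N].

Definition chart_sum : set fun_field :=
  fun z => exists u v, [/\ chart_fin u, chart_inf v & z = u + v].

(* g = dim_K H^1(C, O_C), where the Cech complex of the two charts identifies
   H^1(C, O_C) with the quotient of [overlap] by [chart_sum]; the classes of
   e_0, ..., e_(g-1) form a K-basis of this quotient. *)
Definition genus (g : nat) : Prop :=
  exists e : 'I_g -> fun_field,
    [/\ forall i, overlap (e i),
        forall z, overlap z -> exists c : 'I_g -> K,
          chart_sum (z - \sum_(i < g) of_const (c i) * e i)
      & forall c : 'I_g -> K,
          chart_sum (\sum_(i < g) of_const (c i) * e i) -> forall i, c i = 0].

End SmoothModel.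

(* Both notions concern curves over a field with p ^ m elements, m even. *)
Definition maximal_curve (p m : nat) (K : fieldType) (h : {poly {poly K}}) :=
  exists g N : nat, [/\ genus h g, num_points h N
    & N%:Z = (p ^ m)%:Z + 1 + 2 * g%:Z * (p ^ m./2)%:Z].

Definition minimal_curve (p m : nat) (K : fieldType) (h : {poly {poly K}}) :=
  exists g N : nat, [/\ genus h g, num_points h N
    & N%:Z = (p ^ m)%:Z + 1 - 2 * g%:Z * (p ^ m./2)%:Z].

(* The inner variable is x and the outer variable is y. *)
Definition curve_C (p l : nat) (K : fieldType) (gamma beta : K) :
    {poly {poly K}} :=
  'X^p - 'X - (gamma *: 'X^(p ^ l + 1) + beta *: 'X)%:P.

Definition power_set (p l : nat) (F : finFieldType) : {set F} :=
  finset (fun z : F => [exists x : F, (x != 0) && (z == x ^+ (p ^ l + 1))]).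

Definition num_maximal (p m l : nat) (F : finFieldType) (gamma : F) : nat :=
  #|[pred beta : F | `[< maximal_curve p m (curve_C p l gamma beta) >]]|.

Definition num_minimal (p m l : nat) (F : finFieldType) (gamma : F) : nat :=
  #|[pred beta : F | `[< minimal_curve p m (curve_C p l gamma beta) >]]|.

(* Main.v *)
Require Import Defs.
From HB Require Import structures.
From mathcomp Require Import all_boot all_order all_algebra all_field.
From mathcomp Require Import boolp classical_sets cardinality functions.
From mathcomp Require Import generic_quotient zify ring.

(** Write q = p^l, m = 2 l s, L = K(x)[y] / (y^p - y - f) with
    f = gamma x^(q+1) + beta x over the field K with p^m elements, and Tr for
    the trace from K to its prime field.

    Geometry.  The curve has one point at infinity and p points over each a
    with Tr (f(a)) = 0, and its genus is g = q (p - 1) / 2, for every beta.  To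
    see this the two charts are computed in the basis 1, y, ..., y^(p-1) of L
    over K(x), for any f of degree n prime to p.  The finite chart is
    K[x] + K[x] y + ... + K[x] y^(p-1) (chart_finP); the sum of the a_i y^i
    lies in the chart at infinity exactly when each a_i is a Laurent polynomial
    in x with p deg a_i + i n <= 0 (chart_inf_deg, chart_inf_monomial).  One
    device gives both: z^(p^k) is obtained from z by raising the coefficients to
    the power p^k and translating y, while the powers of an integral element
    stay in a finitely generated module.  A coefficient that violates the
    condition would give the coordinates of the z^(p^k) unbounded denominators or
    degrees.  The monomials x^-j y^i with 0 < j <= i n / p are then a basis of
    H^1 (genus_artin_schreier), the ideals of the finite chart with residue field K
    are the affine points (card_fin_points), and the radical of the ideal
    generated by 1/x is the only point at infinity (card_inf_points).

    Arithmetic.  So the curve has 1 + p M points, M being the number of zeros of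
    Q(x) + Tr (beta x) for the quadratic form Q(x) = Tr (gamma x^(q+1)).  In each
    case of the theorem some w0 <> 0 has (gamma w0^(q+1))^(q-1) = -1; then the
    radical W of the polar form of Q is w0 times the field with q^2 elements,
    and Q vanishes on W.  Let N(c) be the number of solutions of Q(x) = c.
    Since every nonzero c of the prime field is a (q+1)-st power, N(c) = N(1)
    for c <> 0.  A second moment computation gives
    (N(0) - N(1))^2 = p^m |W| = q^(2s+2), and the sign is found modulo q + 1:
    the nonzero solutions of Q(x) = c come in orbits of the group of (q+1)-st
    roots of unity, so that N(0) - N(1) = (-q)^(s+1) (level_gapE).

    If beta is not orthogonal to W then M = p^(m-1), and the curve is neither
    maximal nor minimal.  Otherwise Tr (beta x) is the polar form of x and some
    z, completing the square gives M = N(Q(z)), and each beta arises from q^2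
    elements z.  Now p N(0) = p^m + (p-1) (-q)^(s+1) is always extremal, while
    p N(1) = p^m - (-q)^(s+1) is extremal only for p = 2.  Hence N(0) / q^2
    elements beta give the extremal curves whose type is determined by the
    parity of s, and for p = 2 another N(1) / q^2 give those of the other
    type. *)

Set Implicit Arguments.
Unset Strict Implicit.
Unset Printing Implicit Defensive.

Import Order.TTheory GRing.Theory Num.Theory.
Local Open Scope ring_scope.

(** * Frobenius powers and integral elements *)

Lemma expV_cancel (R : fieldType) (a : R) i j :
  a != 0 -> a ^+ (i * j) * (a^-1 ^+ j) ^+ i = 1.
Proof. by move=> a0; rewrite -exprM [(j * i)%N]mulnC exprVn mulfV // expf_neq0. Qed.

Lemma expVD_cancel (R : fieldType) (a : R) m d :
  a != 0 -> a^-1 ^+ d * a ^+ (m + d) = a ^+ m.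
Proof.
by move=> a0; rewrite exprVn exprD mulrCA mulVf ?mulr1 // expf_neq0.
Qed.

Section FrobeniusPowers.

Variables (R : comNzRingType) (p : nat).
Hypothesis charR : p \in [pchar R].

Lemma exprD_pchar k (x y : R) :
  (x + y) ^+ (p ^ k) = x ^+ (p ^ k) + y ^+ (p ^ k).
Proof.
apply: exprDn_pchar; apply/pnatP; first by rewrite expn_gt0 (prime_gt0 (pcharf_prime charR)).
move=> r r_pr; rewrite Euclid_dvdX // => /andP[+ _].
by rewrite (dvdn_prime2 r_pr (pcharf_prime charR)) => /eqP ->.
Qed.

Lemma expr_sum_pchar k I (r : seq I) (P : pred I) (F : I -> R) :
  (\sum_(i <- r | P i) F i) ^+ (p ^ k) = \sum_(i <- r | P i) F i ^+ (p ^ k).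
Proof.
apply: (big_morph (fun x => x ^+ (p ^ k)) (exprD_pchar k)).
by rewrite expr0n expn_eq0 eqn0Ngt (prime_gt0 (pcharf_prime charR)).
Qed.

End FrobeniusPowers.

Section IntegralPowers.

Variables (R S : comNzRingType) (phi : {rmorphism R -> S}).

(** Division of 'X^N by an integral equation of z brings z ^+ N into a module with
    generators that do not depend on N. *)
Lemma integral_pow_span z : integralOver phi z ->
  exists d, forall N, exists c : nat -> R,
    z ^+ N = \sum_(j < d) phi (c j) * z ^+ j.
Proof.
case=> P monP /rootP Pz0; exists (size P) => N.
exists (fun j => (Pdiv.Ring.rmodp 'X^N P)`_j).
have mon1 : map_poly phi P \is monic by apply: monic_map.
have := congr1 (fun Q => (map_poly phi Q).[z]) (Pdiv.RingMonic.rdivp_eq monP 'X^N).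
rewrite /= map_polyXn hornerXn rmorphD rmorphM /= hornerD hornerM Pz0 mulr0 add0r.
move=> ->; rewrite (horner_coef_wide _ (n := size P)).
  by apply: eq_bigr => i _; rewrite coef_map.
apply: leq_trans (size_poly _ _) _.
exact/ltnW/Pdiv.Ring.ltn_rmodpN0/monic_neq0.
Qed.

Lemma integral_root_pow z k : (0 < k)%N ->
  integralOver phi (z ^+ k) -> integralOver phi z.
Proof.
move=> k_gt0 zk; apply: (@integral_root_monic _ _ _ _ ('X^k - (z ^+ k)%:P)).
- exact: monicXnsubC.
- by rewrite rootE !hornerE subrr.
apply/integral_poly => i; rewrite coefB coefXn coefC.
by apply: integral_sub; [exact: integral_nat | case: eqP => // _; exact: integral0].
Qed.

Lemma integral_exp z k : integralOver phi z -> integralOver phi (z ^+ k).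
Proof.
by move=> zi; elim: k => [|k IH]; rewrite ?expr0 ?exprS; [apply: integral1 | apply: integral_mul].
Qed.

Lemma integral_sum I (r : seq I) (P : pred I) (F : I -> S) :
  (forall i, P i -> integralOver phi (F i)) ->
  integralOver phi (\sum_(i <- r | P i) F i).
Proof.
move=> intF; apply: (big_ind (integralOver phi)) => //; first exact: integral0.
exact: integral_add.
Qed.

End IntegralPowers.

(** * Degrees of Laurent polynomials in K(x) *)

Section RationalFunctions.

Variable K : fieldType.
Local Notation E := {fraction {poly K}}.
Local Notation "P %:F" := (@FracField.tofrac {poly K} P) (at level 1).
Local Notation x := (ratfun_x K).

Lemma fraction_quot (e : E) : exists P Q : {poly K}, Q != 0 /\ e = P%:F / Q%:F.
Proof.
elim/quotW: e => r; exists (\n_r), (\d_r); split; first exact: denom_ratioP.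
apply: (@mulIf _ (\d_r)%:F); first by rewrite tofrac_eq0 denom_ratioP.
rewrite mulfVK ?tofrac_eq0 ?denom_ratioP //.
unlock FracField.tofrac; rewrite -[LHS]FracField.pi_mul; apply/eqmodP.
rewrite /= FracField.equivfE /FracField.mulf /=.
have d0 := denom_ratioP r.
by rewrite !numden_Ratio ?mulf_neq0 ?oner_eq0 // mulr1 mulrC mulr1.
Qed.

Lemma ratfun_x_neq0 : x != 0.
Proof. by rewrite tofrac_eq0 polyX_eq0. Qed.

Definition is_polynomial (e : E) := exists P : {poly K}, e = P%:F.

(** Multiplying by a power of x clears the denominator, so the degree of a Laurent
    polynomial is read off as the size of a polynomial, shifted by that power.  The
    condition also says that e is a Laurent polynomial; 0 satisfies it for all d. *)
Definition deg_le (e : E) (d : int) :=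
  exists N (P : {poly K}), e * x ^+ N = P%:F /\ (size P)%:Z <= N%:Z + 1 + d.

Definition has_deg (e : E) (d : int) :=
  exists N (P : {poly K}),
    [/\ e * x ^+ N = P%:F, P != 0 & (size P)%:Z = N%:Z + 1 + d].

Lemma deg_leW e d d' : d <= d' -> deg_le e d -> deg_le e d'.
Proof. by move=> dd' [N [P [eP sP]]]; exists N, P; split=> //; lia. Qed.

Lemma has_deg_le e d : has_deg e d -> deg_le e d.
Proof. by case=> N [P [eP P0 sP]]; exists N, P; split=> //; lia. Qed.

(** The condition can be tested on any power of x that clears the denominator. *)
Lemma deg_leP e d N (P : {poly K}) : e * x ^+ N = P%:F -> 
  deg_le e d <-> (P = 0 \/ (size P)%:Z <= N%:Z + 1 + d).
Proof.
move=> eP; split=> [[M [Q [eQ sQ]]]|[P0|]]; last by exists N, P.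
  have [->|P0] := eqVneq P 0; [by left | right].
  have : P * 'X^M = Q * 'X^N.
    apply/eqP; rewrite -tofrac_eq !tofracM -eP -eQ !tofracXn -/x.
    by rewrite -!mulrA [x ^+ N * _]mulrC.
  move=> /(congr1 (fun A : {poly K} => size A)).
  rewrite size_mulXn // size_mulXn; first by lia.
  apply: contra_neq P0 => Q0; apply/eqP; rewrite -tofrac_eq0 -eP mulf_eq0.
  move: eQ; rewrite Q0 tofrac0 => /eqP; rewrite mulf_eq0 expf_eq0.
  by rewrite (negPf ratfun_x_neq0) andbF orbF => ->.
have e0 : e = 0.
  apply/eqP; move/eqP: eP; rewrite P0 tofrac0 mulf_eq0 expf_eq0.
  by rewrite (negPf ratfun_x_neq0) andbF orbF.
exists `|d|%N, 0; rewrite e0 mul0r tofrac0 size_poly0; split=> //; lia.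
Qed.

Lemma has_deg_le_leq e d d' : has_deg e d -> deg_le e d' -> d <= d'.
Proof.
case=> N [P [eP P0 sP]] /(deg_leP _ eP) [/eqP|]; last by lia.
by rewrite (negPf P0).
Qed.

Lemma deg_le0 d : deg_le 0 d.
Proof. by apply/(@deg_leP _ _ 0 0); [rewrite mul0r tofrac0 | left]. Qed.

Lemma deg_leD e e' d : deg_le e d -> deg_le e' d -> deg_le (e + e') d.
Proof.
case=> N [P [eP sP]] [M [Q [eQ sQ]]].
exists (N + M)%N, (P * 'X^M + Q * 'X^N); split.
  rewrite tofracD !tofracM !tofracXn -/x -eP -eQ exprD.
  by rewrite mulrDl -!mulrA [x ^+ M * _]mulrC.
have := size_polyD (P * 'X^M) (Q * 'X^N); move: sP sQ.
have [->|P0] := eqVneq P 0; have [->|Q0] := eqVneq Q 0;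
  rewrite ?(mul0r, add0r, addr0, size_poly0) ?size_mulXn //; try lia.
set a := size (P * _ + _ : {poly K}); move: a => a; lia.
Qed.

Lemma deg_leM e e' d d' : deg_le e d -> deg_le e' d' -> deg_le (e * e') (d + d').
Proof.
case=> N [P [eP sP]] [M [Q [eQ sQ]]].
have ePQ : e * e' * x ^+ (N + M) = (P * Q)%:F.
  by rewrite tofracM -eP -eQ exprD mulrACA.
apply/(deg_leP _ ePQ).
have [->|P0] := eqVneq P 0; first by left; rewrite mul0r.
have [->|Q0] := eqVneq Q 0; first by left; rewrite mulr0.
right; rewrite size_mul //.
move: P0 Q0 sP sQ; rewrite -!size_poly_gt0; move: (size P) (size Q) => a b; lia.
Qed.

Lemma deg_le_sum I (r : seq I) (A : pred I) (F : I -> E) d :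
  (forall i, A i -> deg_le (F i) d) -> deg_le (\sum_(i <- r | A i) F i) d.
Proof.
move=> dF; apply: (big_ind (fun e => deg_le e d)) => //; first exact: deg_le0.
by move=> ? ?; exact: deg_leD.
Qed.

Lemma has_degM e e' d d' :
  has_deg e d -> has_deg e' d' -> has_deg (e * e') (d + d').
Proof.
case=> N [P [eP P0 sP]] [M [Q [eQ Q0 sQ]]]; exists (N + M)%N, (P * Q).
rewrite mulf_neq0 // size_mul // tofracM -eP -eQ exprD mulrACA; split=> //.
move: P0 Q0 sP sQ; rewrite -!size_poly_gt0; move: (size P) (size Q) => a b; lia.
Qed.

Lemma has_deg_poly (P : {poly K}) : P != 0 -> has_deg P%:F ((size P)%:Z - 1).
Proof. by move=> P0; exists 0, P; rewrite mulr1; split=> //; lia. Qed.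

Lemma has_degX e d k : has_deg e d -> has_deg (e ^+ k) (d *+ k).
Proof.
move=> de; elim: k => [|k IH]; last by rewrite exprS mulrS; exact: has_degM.
rewrite expr0 mulr0n -tofrac1.
have := has_deg_poly (oner_neq0 {poly K}); rewrite size_poly1 subrr; exact.
Qed.

Lemma deg_leX e d k : deg_le e d -> deg_le (e ^+ k) (d *+ k).
Proof.
move=> de; elim: k => [|k IH]; last by rewrite exprS mulrS; exact: deg_leM.
rewrite expr0 mulr0n -tofrac1; apply: has_deg_le.
have := has_deg_poly (oner_neq0 {poly K}); rewrite size_poly1 subrr; exact.
Qed.

Lemma has_degDl e e' d d' :
  has_deg e d -> deg_le e' d' -> d' < d -> has_deg (e + e') d.
Proof.
case=> N [P [eP P0 sP]] [M [Q [eQ sQ]]] dd'.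
have eX : (e + e') * x ^+ (N + M) = (P * 'X^M + Q * 'X^N)%:F.
  rewrite tofracD !tofracM !tofracXn -/x -eP -eQ exprD.
  by rewrite mulrDl -!mulrA [x ^+ M * _]mulrC.
have ltQ : (size (Q * 'X^N)%R < size (P * 'X^M)%R)%N.
  have [->|Q0] := eqVneq Q 0.
    by rewrite mul0r size_poly0 size_mulXn // addn_gt0 size_poly_gt0 P0 orbT.
  rewrite !size_mulXn //; lia.
exists (N + M)%N, (P * 'X^M + Q * 'X^N); rewrite eX -size_poly_gt0 size_polyDl //.
split=> //; first by lia.
rewrite size_mulXn //; lia.
Qed.

Lemma deg_le_has_deg e d : deg_le e d -> e != 0 -> exists2 d', has_deg e d' & d' <= d.
Proof.
case=> N [P [eP sP]] e0; exists ((size P)%:Z - N%:Z - 1); last by lia.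
exists N, P; split=> //; last by lia.
apply: contra_neq e0 => P0; apply/eqP; move/eqP: eP.
by rewrite P0 tofrac0 mulf_eq0 expf_eq0 (negPf ratfun_x_neq0) andbF orbF.
Qed.

Lemma deg_le_poly (P : {poly K}) : deg_le P%:F ((size P)%:Z - 1).
Proof. by exists 0, P; rewrite mulr1; split=> //; lia. Qed.

Lemma has_deg_x : has_deg x 1.
Proof.
have := has_deg_poly (negbT (polyX_eq0 K)); rewrite size_polyX; exact.
Qed.

Lemma has_deg_Vx : has_deg x^-1 (-1).
Proof.
exists 1, 1; rewrite expr1 mulVf ?ratfun_x_neq0 // tofrac1 size_poly1 oner_eq0.
by split=> //; lia.
Qed.

Lemma polynomial_neg_deg P d : deg_le P%:F d -> d < 0 -> P = 0.
Proof.
move=> dP d0; apply/eqP; apply: contraTT d0 => P0.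
have := has_deg_le_leq (has_deg_poly P0) dP.
move: P0; rewrite -size_poly_gt0; move: (size P) => a; lia.
Qed.

(** The embedding of K[s] in K(x), seen as a map on polynomials in an indeterminate;
    the charts are integral closures of its range for s = x and s = 1/x. *)
Definition chart_coef (s : E) (a : {poly K}) : E := (map_poly (@ratfun_const K) a).[s].

Lemma ratfun_const_zmod : zmod_morphism (@ratfun_const K).
Proof. by move=> a b; rewrite /ratfun_const polyCB tofracB. Qed.
Lemma ratfun_const_monoid : monoid_morphism (@ratfun_const K).
Proof. by split=> [|a b]; rewrite /ratfun_const ?tofrac1 // polyCM tofracM. Qed.
HB.instance Definition _ := GRing.isZmodMorphism.Build _ _ (@ratfun_const K) ratfun_const_zmod.
HB.instance Definition _ := GRing.isMonoidMorphism.Build _ _ (@ratfun_const K) ratfun_const_monoid.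

Lemma chart_coef_x a : chart_coef x a = a%:F.
Proof.
rewrite /chart_coef; elim/poly_ind: a => [|a c IH].
  by rewrite rmorph0 horner0 tofrac0.
by rewrite rmorphD rmorphM /= map_polyX map_polyC hornerMXaddC IH tofracD tofracM.
Qed.

Lemma chart_coef_Vx_deg a : deg_le (chart_coef x^-1 a) 0.
Proof.
rewrite /chart_coef horner_coef; apply: deg_le_sum => i _.
rewrite coef_map /=; apply: (@deg_leW _ (0 + (-1) *+ i)).
  by rewrite add0r mulrn_wle0.
apply: deg_leM; last exact/has_deg_le/has_degX/has_deg_Vx.
exists 0, (a`_i)%:P; rewrite mulr1; split=> //.
by rewrite size_polyC; case: eqP; lia.
Qed.

(** With chart_coef_Vx_deg this identifies K[1/x] with the Laurent polynomials of
    degree at most 0. *)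
Lemma deg_le0_chart_coef e : deg_le e 0 -> exists a, e = chart_coef x^-1 a.
Proof.
case=> N [P [eP sP]].
have x0 := ratfun_x_neq0.
exists (\sum_(k < size P) P`_k *: 'X^(N - k)).
rewrite /chart_coef rmorph_sum /= horner_sum.
apply: (@mulIf _ (x ^+ N)); first by rewrite expf_neq0.
rewrite eP -chart_coef_x /chart_coef horner_coef size_map_poly mulr_suml.
apply: eq_bigr => i _.
rewrite -mul_polyC rmorphM /= map_polyXn map_polyC hornerCM hornerXn coef_map /=.
rewrite -mulrA; congr (_ * _).
have iN : (i <= N)%N by have := ltn_ord i; lia.
by rewrite exprVn -[in x ^+ N](subnK iN) exprD mulrA mulVf ?mul1r ?expf_neq0.
Qed.

(** The denominator Q of e in lowest terms satisfies: Q^(p^k) divides the fixed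
    polynomial D for all k, hence Q is constant. *)
Lemma polynomial_integrally_closed (e D : E) p : (1 < p)%N ->
  D != 0 -> is_polynomial D -> (forall k, is_polynomial (D * e ^+ (p ^ k))) ->
  is_polynomial e.
Proof.
move=> p_gt1 D0 [d Dd] De; move: D0 De; rewrite Dd tofrac_eq0 => {D Dd} D0 De.
have [P [Q [Q0 eE]]] := fraction_quot e.
pose g := gcdp P Q.
have g0 : g != 0 by rewrite gcdp_eq0 negb_and Q0 orbT.
pose P1 := P %/ g; pose Q1 := Q %/ g.
have PE : P = P1 * g by rewrite divpK // dvdp_gcdl.
have QE : Q = Q1 * g by rewrite divpK // dvdp_gcdr.
have Q10 : Q1 != 0 by apply: contra_neq Q0 => Q10; rewrite QE Q10 mul0r.
have cop : coprimep P1 Q1.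
  by apply: coprimep_div_gcd; rewrite Q0 orbT.
have eE1 : e = P1%:F / Q1%:F.
  by rewrite eE PE QE !tofracM -mulf_div divff ?mulr1 ?tofrac_eq0.
have dvdQ k : Q1 ^+ (p ^ k) %| d.
  have [W eW] := De k; move: eW; rewrite eE1 expr_div_n mulrA.
  move/(canRL (mulfVK _)) => /(_ (expf_neq0 _ _)); rewrite tofrac_eq0 => /(_ Q10) /eqP.
  rewrite -!tofracXn -!tofracM tofrac_eq => /eqP dPW.
  have : Q1 ^+ (p ^ k) %| d * P1 ^+ (p ^ k) by rewrite dPW dvdp_mull.
  by rewrite Gauss_dvdpl // coprimep_expl // coprimep_expr // coprimep_sym.
have sQ1 : size Q1 = 1.
  have := dvdp_leq D0 (dvdQ (size d)); have := size_exp Q1 (p ^ size d).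
  have := ltn_expl (size d) p_gt1; move: Q10; rewrite -size_poly_gt0.
  move: (size d) (size Q1) => C [|[|D]] //= _.
  rewrite mulSn => ltCB eA leA.
  have : (p ^ C + D * p ^ C <= C)%N by rewrite -eA; exact: leq_trans (leq_pred _) leA.
  lia.
have [c c0 Q1E] : exists2 c, c != 0 & Q1 = c%:P by apply/size_poly1P; rewrite sQ1.
exists (c^-1 *: P1); rewrite eE1 Q1E; apply: (canLR (mulfK _)).
  by rewrite tofrac_eq0 polyC_eq0.
by rewrite -tofracM -mul_polyC mulrAC -polyCM mulVf // mul1r.
Qed.

End RationalFunctions.

(** * The function field and its charts *)

Section ChartCoef.
Variables (K : fieldType) (s : {fraction {poly K}}).

Lemma chart_coef_zmod : zmod_morphism (chart_coef s).
Proof. by move=> a b; rewrite /chart_coef rmorphB hornerD hornerN. Qed.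

Lemma chart_coef_monoid : monoid_morphism (chart_coef s).
Proof. by split=> [|a b]; rewrite /chart_coef ?rmorph1 ?hornerC // rmorphM hornerM. Qed.

HB.instance Definition _ :=
  GRing.isZmodMorphism.Build _ _ (chart_coef s) chart_coef_zmod.
HB.instance Definition _ :=
  GRing.isMonoidMorphism.Build _ _ (chart_coef s) chart_coef_monoid.

End ChartCoef.

Section FunField.
Variables (K : fieldType) (h : {poly {poly K}}).
Local Notation E := {fraction {poly K}}.
Local Notation L := (fun_field h).

HB.instance Definition _ := GRing.ComNzRing.on L.
HB.instance Definition _ := GRing.Algebra.on L.

Lemma of_ratfun_zmod : zmod_morphism (@of_ratfun K h).
Proof. by move=> a b; rewrite /of_ratfun scalerBl. Qed.

Lemma of_ratfun_monoid : monoid_morphism (@of_ratfun K h).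
Proof.
split=> [|a b]; first exact: scale1r.
by rewrite /of_ratfun -scalerAl mul1r scalerA.
Qed.

HB.instance Definition _ :=
  GRing.isZmodMorphism.Build E L (@of_ratfun K h) of_ratfun_zmod.
HB.instance Definition _ :=
  GRing.isMonoidMorphism.Build E L (@of_ratfun K h) of_ratfun_monoid.

Lemma of_ratfunE s (z : L) : of_ratfun h s * z = s *: z.
Proof. by rewrite /of_ratfun -scalerAl mul1r. Qed.

(** The structure map of a chart, as a composite for which a ring morphism structure
    is inferred. *)
Definition chart_map s : {poly K} -> L := @of_ratfun K h \o chart_coef s.
HB.instance Definition _ s := GRing.RMorphism.on (chart_map s).

Lemma chartE s z : chart s z = integralOver (chart_map s) z.
Proof. by []. Qed.

Lemma chart_ratfun s a : chart s (of_ratfun h (chart_coef s a)).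
Proof. exact: (integral_id (chart_map s)). Qed.

Lemma chart_fin_polynomial a : is_polynomial a -> chart_fin (of_ratfun h a).
Proof. by case=> A ->; rewrite -chart_coef_x; apply: chart_ratfun. Qed.

End FunField.

(** * The finite chart of an Artin-Schreier curve *)

Definition artin_schreier (K : fieldType) (p : nat) (f : {poly K}) :
  {poly {poly K}} := 'X^p - 'X - f%:P.

Section ArtinSchreier.
Variables (K : fieldType) (p : nat) (f : {poly K}).
Hypothesis charK : p \in [pchar K].
Local Notation E := {fraction {poly K}}.
Local Notation "P %:F" := (@FracField.tofrac {poly K} P) (at level 1).
Local Notation h := (artin_schreier p f).
Local Notation L := (fun_field h).
Local Notation x := (ratfun_x K).
Local Notation coord z i := ((polyn (z : L))`_i).

Let p_pr : prime p. Proof. exact: pcharf_prime charK. Qed.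
Let p_gt1 : (1 < p)%N. Proof. exact: prime_gt1. Qed.

Lemma charE : p \in [pchar E].
Proof.
rewrite inE p_pr /= -(rmorph_nat (@FracField.tofrac {poly K})) tofrac_eq0.
by rewrite -polyC_natr polyC_eq0 (pcharf0 charK).
Qed.

Lemma charL : p \in [pchar L].
Proof. by rewrite pchar_qpoly charE. Qed.

Lemma size_artin_schreier (R : nzRingType) (c : R) :
  size ('X^p - 'X - c%:P : {poly R}) = p.+1.
Proof.
rewrite -addrA size_polyDl size_polyXn // -opprD size_polyN.
apply: leq_ltn_trans (size_polyD _ _) _; rewrite size_polyX size_polyC.
by case: eqP => _; rewrite gtn_max /=; lia.
Qed.

Lemma monic_artin_schreier (R : nzRingType) (c : R) :
  ('X^p - 'X - c%:P : {poly R}) \is monic.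
Proof.
rewrite monicE /lead_coef size_artin_schreier /= !coefB coefXn coefX coefC eqxx.
have -> : (p == 1)%N = false by apply/eqP; lia.
have -> : (p == 0)%N = false by apply/eqP; lia.
by rewrite !subr0.
Qed.

Lemma map_artin_schreier :
  map_poly (@FracField.tofrac {poly K}) h = 'X^p - 'X - (f%:F)%:P.
Proof. by rewrite /artin_schreier !rmorphB /= map_polyXn map_polyX map_polyC. Qed.

Lemma mk_monic_artin_schreier :
  mk_monic (map_poly (@FracField.tofrac {poly K}) h) = 'X^p - 'X - (f%:F)%:P.
Proof.
rewrite /mk_monic map_artin_schreier size_artin_schreier monic_artin_schreier.
by rewrite ltnS (prime_gt0 p_pr).
Qed.

(** A name for the quotient map whose codomain is the function field. *)
Definition inL (A : {poly E}) : L := in_qpoly _ A.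

Lemma inL_zmod : zmod_morphism inL.
Proof. exact: (rmorphB (in_qpoly (map_poly (@FracField.tofrac {poly K}) h))). Qed.

Lemma inL_monoid : monoid_morphism inL.
Proof. exact: in_qpoly_monoid_morphism. Qed.

HB.instance Definition _ := GRing.isZmodMorphism.Build {poly E} L inL inL_zmod.
HB.instance Definition _ := GRing.isMonoidMorphism.Build {poly E} L inL inL_monoid.

Lemma inL_small (A : {poly E}) : (size A <= p)%N -> polyn (inL A) = A.
Proof.
by move=> sA; apply: in_qpoly_small; rewrite mk_monic_artin_schreier size_artin_schreier.
Qed.

Lemma inLZ a A : inL (a *: A) = a *: inL A.
Proof. exact: in_qpolyZ. Qed.

Lemma size_L (z : L) : (size (polyn z) <= p)%N.
Proof.
have /(congr1 (fun A : {poly E} => size A)) sh := mk_monic_artin_schreier.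
by rewrite -ltnS -(size_artin_schreier f%:F) -sh size_mk_monic.
Qed.

Lemma inLK (z : L) : inL (polyn z) = z.
Proof. by apply: val_inj; apply: inL_small; exact: size_L. Qed.

Definition gen_y : L := inL 'X.

Lemma inLE A : inL A = \sum_(i < size A) A`_i *: gen_y ^+ i.
Proof.
rewrite -[in LHS](coefK A) poly_def rmorph_sum /=; apply: eq_bigr => i _.
by rewrite inLZ rmorphXn.
Qed.

Lemma yp : gen_y ^+ p = gen_y + of_ratfun h f%:F.
Proof.
have h0 : inL ('X^p - 'X - (f%:F)%:P) = 0.
  apply: val_inj; rewrite /inL /= mk_monic_artin_schreier.
  by rewrite Pdiv.RingMonic.rmodpp ?monic_artin_schreier.
apply/eqP; rewrite -subr_eq0 opprD addrA -h0 !rmorphB /= rmorphXn /gen_y -/gen_y.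
apply/eqP; congr (_ - _).
by rewrite -[in RHS](mulr1 (_%:P)) mul_polyC inLZ rmorph1.
Qed.

Lemma inLC c : inL c%:P = of_ratfun h c.
Proof. by rewrite -[c%:P]mulr1 mul_polyC inLZ rmorph1. Qed.

Lemma coordE (z : L) : z = \sum_(i < p) coord z i *: gen_y ^+ i.
Proof.
rewrite -[LHS]inLK inLE (big_ord_widen p (fun i => coord z i *: gen_y ^+ i) (size_L z)).
rewrite [RHS](bigID (fun i : 'I_p => (i < size (polyn z))%N)) /=.
rewrite [X in _ = _ + X]big1 ?addr0 // => i; rewrite -leqNgt => si.
by rewrite nth_default // scale0r.
Qed.

Lemma coord_eqP (z w : L) : (forall i, (i < p)%N -> coord z i = coord w i) -> z = w.
Proof.
by move=> zw; rewrite [z]coordE [w]coordE; apply: eq_bigr => i _; rewrite zw.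
Qed.

Lemma coord_default (z : L) i : (p <= i)%N -> coord z i = 0.
Proof. by move=> pi; rewrite nth_default // (leq_trans (size_L z)). Qed.

Lemma coordD (z w : L) i : coord (z + w) i = coord z i + coord w i.
Proof. exact: coefD. Qed.
Lemma coordN (z : L) i : coord (- z) i = - coord z i.
Proof. exact: coefN. Qed.
Lemma coordZ a (z : L) i : coord (a *: z) i = a * coord z i.
Proof. exact: coefZ. Qed.
Lemma coord_suml I (r : seq I) (P : pred I) (F : I -> L) i :
  coord (\sum_(j <- r | P j) F j) i = \sum_(j <- r | P j) coord (F j) i.
Proof. by rewrite poly_of_qpoly_sum coef_sum. Qed.

Lemma coord_yX i j : (i < p)%N -> coord (gen_y ^+ i) j = (j == i)%:R.
Proof.
by move=> ip; rewrite /gen_y -rmorphXn inL_small ?size_polyXn // coefXn.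
Qed.

Lemma coord_sum (c : 'I_p -> E) (i : 'I_p) :
  coord (\sum_j c j *: gen_y ^+ j) i = c i.
Proof.
rewrite coord_suml (bigD1 i) //= coordZ coord_yX // eqxx mulr1 big1 ?addr0 // => j ji.
by rewrite coordZ coord_yX // eq_sym (inj_eq val_inj) (negPf ji) mulr0.
Qed.

(** The Frobenius map to the power p^k translates y by this rational function. *)
Definition frob_shift k : E := \sum_(i < k) (f%:F) ^+ (p ^ i).

Lemma y_frob k : gen_y ^+ (p ^ k) = gen_y + of_ratfun h (frob_shift k).
Proof.
elim: k => [|k IH]; first by rewrite expr1 /frob_shift big_ord0 rmorph0 addr0.
rewrite expnSr exprM IH -[X in _ ^+ X]expn1 (exprD_pchar charL) expn1 yp.
rewrite -addrA; congr (_ + _); rewrite -rmorphXn -rmorphD; congr (of_ratfun _ _).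
rewrite /frob_shift big_ord_recl /= expr1; congr (_ + _).
rewrite -[X in _ ^+ X]expn1 (expr_sum_pchar charE); apply: eq_bigr => i _.
by rewrite expn1 -exprM -expnSr.
Qed.

(** Frobenius is a ring morphism that sends y to y + F_k, so it acts on the
    coordinates by p^k-th powers followed by the substitution of 'X + F_k for 'X. *)
Lemma polyn_frob k (z : L) :
  polyn (z ^+ (p ^ k)) =
  map_poly (fun a => a ^+ (p ^ k)) (polyn z) \Po ('X + (frob_shift k)%:P).
Proof.
have q0 : (p ^ k != 0)%N by rewrite expn_eq0; case: (p) p_gt1.
set A := map_poly _ (polyn _).
have cA i : A`_i = coord z i ^+ (p ^ k).
  by rewrite coef_map_id0 //= expr0n (negPf q0).
have sA : (size A <= p)%N.
  by apply: leq_trans (size_L z); apply: size_poly.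
have yE : inL ('X + (frob_shift k)%:P) = gen_y ^+ (p ^ k).
  by rewrite y_frob -inLC -(rmorphD inL).
rewrite -[RHS]inL_small ?size_comp_poly2 ?size_XaddC //; congr (polyn _).
have AE : A = \sum_(i < p) coord z i ^+ (p ^ k) *: 'X^i.
  rewrite -(poly_def p (fun i => coord z i ^+ (p ^ k))); apply/polyP => i.
  by rewrite cA coef_poly; case: ltnP => // pi; rewrite coord_default // expr0n (negPf q0).
rewrite AE -[RHS]/(inL (comp_poly _ _)) (raddf_sum (comp_poly _)) (rmorph_sum inL).
rewrite {1}[z]coordE (expr_sum_pchar charL); apply: eq_bigr => i _.
rewrite /= comp_polyZ comp_Xn_poly inLZ (rmorphXn inL) /= yE.
by rewrite -!of_ratfunE exprMn rmorphXn -!exprM mulnC.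
Qed.

Lemma coord0_frob k (z : L) :
  coord (z ^+ (p ^ k)) 0 = \sum_(i < p) coord z i ^+ (p ^ k) * frob_shift k ^+ i.
Proof.
have q0 : (p ^ k != 0)%N by rewrite expn_eq0; case: (p) p_gt1.
rewrite polyn_frob -horner_coef0 horner_comp !hornerE.
rewrite (horner_coef_wide _ (n := p)); last first.
  by apply: leq_trans (size_L z); apply: size_poly.
by apply: eq_bigr => i _; rewrite coef_map_id0 //= expr0n (negPf q0).
Qed.

Lemma coord_top_frob k (z : L) n : (size (polyn z) <= n.+1)%N ->
  coord (z ^+ (p ^ k)) n = coord z n ^+ (p ^ k).
Proof.
have q0 : (p ^ k != 0)%N by rewrite expn_eq0; case: (p) p_gt1.
move=> sz; rewrite polyn_frob; set A := map_poly _ (polyn _).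
have cA i : A`_i = coord z i ^+ (p ^ k).
  by rewrite coef_map_id0 //= expr0n (negPf q0).
have sA : (size A <= n.+1)%N by apply: leq_trans sz; apply: size_poly.
rewrite -cA; move: sA; rewrite leq_eqVlt => /orP[/eqP sA|sA].
  have := lead_coef_comp A (q := 'X + (frob_shift k)%:P).
  rewrite size_XaddC lead_coefXaddC expr1n mulr1 => /(_ isT).
  by rewrite /lead_coef size_comp_poly2 ?size_XaddC // sA.
by rewrite !nth_default // size_comp_poly2 ?size_XaddC.
Qed.

(** All powers of an integral z have their coordinates in one finitely generated
    module over K[s], for each index. *)
Lemma integral_coord_pow s (z : L) : chart s z ->
  exists d, forall N, exists c : nat -> {poly K},
    forall i, coord (z ^+ N) i = \sum_(j < d) chart_coef s (c j) * coord (z ^+ j) i.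
Proof.
rewrite chartE => /integral_pow_span [d dz]; exists d => N.
have [c zN] := dz N; exists c => i; rewrite zN coord_suml; apply: eq_bigr => j _.
by rewrite (of_ratfunE (chart_coef s (c j)) (z ^+ j)) coordZ.
Qed.

Lemma common_denominator (F : nat -> E) d :
  exists2 D : E, D != 0 /\ is_polynomial D & forall j : 'I_d, is_polynomial (D * F j).
Proof.
elim: d => [|d [_D [+ [D DE]]]]; last rewrite {_D}DE => D0 DF.
  exists 1; last by case.
  by split; [rewrite oner_neq0 | exists (1 : {poly K}); rewrite tofrac1].
have [P [Q [Q0 FE]]] := fraction_quot (F d).
exists (D * Q)%:F.
  by split; [move: D0; rewrite !tofrac_eq0 mulf_eq0 negb_or => -> | exists (D * Q)].
move=> j; have [jd|] := ltnP j d.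
  have [W /= eW] := DF (Ordinal jd); exists (Q * W).
  by rewrite !tofracM [_ * Q%:F]mulrC -mulrA eW.
move=> dj; have -> : (j : nat) = d by apply/eqP; rewrite eqn_leq dj -ltnS ltn_ord.
by exists (D * P); rewrite FE !tofracM -mulrA [Q%:F * _]mulrC divfK ?tofrac_eq0.
Qed.

Lemma polynomialM (a b : E) : is_polynomial a -> is_polynomial b -> is_polynomial (a * b).
Proof. by move=> [A ->] [B ->]; exists (A * B); rewrite tofracM. Qed.
Lemma polynomialD (a b : E) : is_polynomial a -> is_polynomial b -> is_polynomial (a + b).
Proof. by move=> [A ->] [B ->]; exists (A + B); rewrite tofracD. Qed.
Lemma polynomial_sum I (r : seq I) (A : pred I) (F : I -> E) :
  (forall i, A i -> is_polynomial (F i)) -> is_polynomial (\sum_(i <- r | A i) F i).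
Proof.
move=> PF; apply: (big_ind (@is_polynomial K)) => //; last exact: polynomialD.
by exists 0; rewrite tofrac0.
Qed.

(** The defining equation of y has coefficients in K[x]. *)
Lemma chart_fin_y : chart_fin gen_y.
Proof.
rewrite /chart_fin chartE; apply: (@integral_root_monic _ _ _ _ ('X^p - 'X - (of_ratfun h f%:F)%:P)).
- exact: monic_artin_schreier.
- by rewrite rootE !hornerE yp [gen_y + _]addrC addrK subrr.
apply/integral_poly => i; rewrite !coefB coefXn coefX coefC.
apply: integral_sub; first by apply: integral_sub; exact: integral_nat.
case: eqP => _; last exact: integral0.
by have := chart_fin_polynomial h (ex_intro _ f erefl); rewrite /chart_fin chartE.
Qed.

(** The leading coordinate a of an integral z is the only one that survives Frobenius
    unmixed: a^(p^k) is a coordinate of z^(p^k), so these powers have a common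
    denominator and a is a polynomial.  Subtracting a y^n lowers the length of z. *)
Lemma chart_finP (z : L) :
  chart_fin z <-> forall i, (i < p)%N -> is_polynomial (coord z i).
Proof.
split=> [|Pz]; last first.
  rewrite [z]coordE /chart_fin chartE; apply: integral_sum => i _.
  rewrite -of_ratfunE; apply: integral_mul; last exact/integral_exp/chart_fin_y.
  by have := chart_fin_polynomial h (Pz i (ltn_ord i)).
suff H n : forall z, (size (polyn z) <= n)%N -> chart_fin z ->
    forall i, is_polynomial (coord z i).
  by move=> zc i _; exact: H (leqnn _) zc _.
elim: n => [|n IH] {}z sz zc i.
  by exists 0; rewrite tofrac0 nth_default // (leq_trans sz).
have Pn : is_polynomial (coord z n).
  have [d dz] := integral_coord_pow zc.
  have [D [D0 PD] DF] := common_denominator (fun j => coord (z ^+ j) n) d.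
  apply: (polynomial_integrally_closed p_gt1 D0 PD) => k.
  rewrite -coord_top_frob //; have [c ->] := dz (p ^ k)%N.
  rewrite mulr_sumr; apply: polynomial_sum => j _.
  rewrite mulrCA; apply: polynomialM; last exact: DF.
  by rewrite chart_coef_x; exists (c j).
(* An index n >= p carries no coordinate, and the induction hypothesis applies as it stands. *)
have [np|pn] := ltnP n p; last first.
  by apply: IH; rewrite // (leq_trans (size_L z)).
pose w := z - coord z n *: gen_y ^+ n.
have cw j : coord w j = coord z j - coord z n * (j == n)%:R.
  by rewrite coordD coordN coordZ coord_yX.
have wc : chart_fin w.
  rewrite /chart_fin chartE; apply: integral_sub; first exact: zc.
  rewrite -of_ratfunE; apply: integral_mul.
    exact: chart_fin_polynomial.
  exact/integral_exp/chart_fin_y.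
have -> : coord z i = coord w i + coord z n * (i == n)%:R by rewrite cw subrK.
apply: polynomialD.
  apply: IH wc _; apply/leq_sizeP => j; rewrite leq_eqVlt => /orP[/eqP <-|nj].
    by rewrite cw eqxx mulr1 subrr.
  by rewrite cw gtn_eqF // mulr0 subr0 nth_default // (leq_trans sz).
apply: polynomialM => //; exists ((i == n)%:R); by rewrite rmorph_nat.
Qed.

End ArtinSchreier.

(** * The chart at infinity *)

Section Infinity.
Variables (K : fieldType) (p n : nat) (f : {poly K}).
Hypothesis charK : p \in [pchar K].
Hypothesis size_f : size f = n.+1.
Hypothesis cop_pn : coprime p n.
Local Notation E := {fraction {poly K}}.
Local Notation "P %:F" := (@FracField.tofrac {poly K} P) (at level 1).
Local Notation h := (artin_schreier p f).
Local Notation L := (fun_field h).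
Local Notation x := (ratfun_x K).
Local Notation y := (gen_y p f).
Local Notation coord z i := ((polyn (z : L))`_i).
Local Notation F_ := (frob_shift p f).

Let p_pr : prime p. Proof. exact: pcharf_prime charK. Qed.
Let p_gt1 : (1 < p)%N. Proof. exact: prime_gt1. Qed.
Let p_gt0 : (0 < p)%N. Proof. exact: prime_gt0. Qed.

Lemma n_gt0 : (0 < n)%N.
Proof.
by case: (n) cop_pn => //; rewrite /coprime gcdn0 => /eqP p1; move: p_gt1; rewrite p1.
Qed.

Lemma has_deg_f : has_deg f%:F n%:Z.
Proof.
have f0 : f != 0 by rewrite -size_poly_gt0 size_f.
by have := has_deg_poly f0; rewrite size_f -addn1 PoszD addrK.
Qed.

(** The last summand of F_k dominates all others. *)
Lemma has_deg_frob_shift k : has_deg (F_ k.+1) (n * p ^ k)%N%:Z.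
Proof.
have fp j : has_deg (f%:F ^+ (p ^ j)) (n * p ^ j)%N%:Z.
  by rewrite PoszM -mulrzz -pmulrn; apply: has_degX; exact: has_deg_f.
elim: k => [|k IH]; first by rewrite /frob_shift big_ord_recl big_ord0 addr0; apply: fp.
rewrite /frob_shift big_ord_recr /= addrC; apply: (has_degDl (fp k.+1)).
  exact: has_deg_le IH.
by rewrite ltz_nat ltn_pmul2l ?n_gt0 // ltn_exp2l.
Qed.

Lemma chart_infM (z w : L) : chart_inf z -> chart_inf w -> chart_inf (z * w).
Proof. by rewrite /chart_inf !chartE => zi wi; apply: integral_mul. Qed.
Lemma chart_infD (z w : L) : chart_inf z -> chart_inf w -> chart_inf (z + w).
Proof. by rewrite /chart_inf !chartE => zi wi; apply: integral_add. Qed.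
Lemma chart_infX (z : L) k : chart_inf z -> chart_inf (z ^+ k).
Proof. by rewrite /chart_inf !chartE => zi; apply: integral_exp. Qed.
Lemma chart_inf_sum I (r : seq I) (A : pred I) (G : I -> L) :
  (forall i, A i -> chart_inf (G i)) -> chart_inf (\sum_(i <- r | A i) G i).
Proof. by move=> zi; rewrite /chart_inf chartE; apply: integral_sum. Qed.
Lemma chart_inf_ratfun a : deg_le a 0 -> chart_inf (of_ratfun h a).
Proof. by case/deg_le0_chart_coef => A ->; apply: chart_ratfun. Qed.

(** Dividing y^p = y + f by x^(n p) gives an equation for x^-n y whose coefficients
    have degree at most 0. *)
Lemma chart_inf_y : chart_inf (x^-1 ^+ n *: y).
Proof.
have dxV k : deg_le (x^-1 ^+ k) (- k%:Z).
  by have := has_degX k (has_deg_Vx K); rewrite mulNrn => /has_deg_le; rewrite pmulrn intz.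
set Y := _ *: y.
pose c := x^-1 ^+ (n * p.-1); pose d := x^-1 ^+ (n * p) * f%:F.
have YE : Y ^+ p = of_ratfun h c * Y + of_ratfun h d.
  rewrite /Y -!of_ratfunE exprMn (yp f charK) -rmorphXn mulrDr mulrA -!(rmorphM (@of_ratfun K h)).
  rewrite /= -exprM; congr (of_ratfun _ _ * _ + _).
  by rewrite /c -exprD addnC -mulnS prednK.
have dc : deg_le c 0 by apply: deg_leW (dxV _); rewrite oppr_le0.
have dd : deg_le d 0.
  apply: (deg_leW _ (deg_leM (dxV _) (has_deg_le has_deg_f))).
  by rewrite addrC subr_le0 lez_nat leq_pmulr.
rewrite /chart_inf chartE.
apply: (@integral_root_monic _ _ _ _ ('X^p - (of_ratfun h c *: 'X + (of_ratfun h d)%:P))).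
- rewrite monicE /lead_coef size_polyDl size_polyXn ?coefB ?coefXn ?eqxx /=; last first.
    rewrite size_polyN; apply: leq_ltn_trans (size_polyD _ _) _; rewrite gtn_max.
    rewrite (leq_ltn_trans (size_scale_leq _ _)) ?size_polyX //=.
    by rewrite size_polyC; case: eqP.
  rewrite coefD coefZ coefX coefC.
  have -> : (p == 1)%N = false by apply/eqP; lia.
  have -> : (p == 0)%N = false by apply/eqP; lia.
  by rewrite mulr0 addr0 subr0.
- by rewrite rootE !hornerE YE subrr.
apply/integral_poly => i; rewrite coefB coefXn coefD coefZ coefX coefC.
apply: integral_sub; first exact: integral_nat.
apply: integral_add.
  apply: integral_mul; last exact: integral_nat.
  exact: (chart_inf_ratfun dc).
case: eqP => _; last exact: integral0.
exact: (chart_inf_ratfun dd).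
Qed.

(** Up to a factor of degree at most 0 this is the i-th power of x^-n y^p = x^-n (y + f),
    which lies in the chart.  The exponent r serves to show that certain elements
    vanish at infinity. *)
Lemma chart_inf_pow a e i r : deg_le a e -> p%:Z * e + (i * n)%N%:Z + r%:Z <= 0 ->
  chart_inf (x ^+ r *: (a *: y ^+ i) ^+ p).
Proof.
move=> ae le0; have x0 := ratfun_x_neq0 K.
have dxV k : deg_le (x^-1 ^+ k) (- k%:Z).
  by have := has_degX k (has_deg_Vx K); rewrite mulNrn => /has_deg_le; rewrite pmulrn intz.
have dx k : deg_le (x ^+ k) (k%:Z).
  by have := has_degX k (has_deg_x K) => /has_deg_le; rewrite pmulrn intz.
have xu : x ^+ (i * n) * (x^-1 ^+ n) ^+ i = 1 by exact: expV_cancel.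
have -> : x ^+ r *: (a *: y ^+ i) ^+ p =
    of_ratfun h (x ^+ r * a ^+ p * x ^+ (i * n)) *
    (x^-1 ^+ n *: y + of_ratfun h (x^-1 ^+ n * f%:F)) ^+ i.
  rewrite -!of_ratfunE exprMn -exprM [(i * p)%N]mulnC exprM (yp f charK).
  have -> : of_ratfun h (x^-1 ^+ n) * y + of_ratfun h (x^-1 ^+ n * f%:F) =
      of_ratfun h (x^-1 ^+ n) * (y + of_ratfun h f%:F).
    by rewrite mulrDr -rmorphM.
  rewrite exprMn !mulrA -!(rmorphXn (@of_ratfun K h)) -!(rmorphM (@of_ratfun K h)) /=; congr (of_ratfun _ _ * _).
  by rewrite -(mulrA _ (x ^+ (i * n))) xu mulr1.
apply: chart_infM.
  apply: chart_inf_ratfun; apply: (deg_leW le0).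
  apply: deg_leW (deg_leM (deg_leM (dx r) (deg_leX p ae)) (dx _)).
  by rewrite pmulrn mulrzz mulrC; lia.
apply/chart_infX/chart_infD; first exact: chart_inf_y.
apply/chart_inf_ratfun/(deg_leW _ (deg_leM (dxV n) (has_deg_le has_deg_f))).
by rewrite addNr.
Qed.

Lemma chart_inf_monomial a e i : deg_le a e -> p%:Z * e + (i * n)%N%:Z <= 0 ->
  chart_inf (a *: y ^+ i).
Proof.
move=> ae le0; rewrite /chart_inf chartE.
apply: (integral_root_pow p_gt0).
rewrite -[_ ^+ p]scale1r -(expr0 x).
by apply: (chart_inf_pow ae); rewrite addr0.
Qed.

(** Rescaling the root of an integral equation over K[1/x] by x^N multiplies the lower
    coefficients by positive powers of x^N, which makes them polynomials in x. *)
Lemma chart_inf_fin z : chart_inf z -> exists N, chart_fin (of_ratfun h (x ^+ N) * z).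
Proof.
rewrite /chart_inf chartE => -[P monP /rootP Pz0].
have x0 := ratfun_x_neq0 K.
have [N PN] : exists N, forall i : 'I_(size P), is_polynomial (chart_coef x^-1 P`_i * x ^+ N).
  have /fin_all_exists [m mP] (i : 'I_(size P)) :
      exists m, is_polynomial (chart_coef x^-1 P`_i * x ^+ m).
    by have [m [Q [eQ _]]] := chart_coef_Vx_deg P`_i; exists m, Q.
  exists (\sum_i m i)%N => i; have [Q eQ] := mP i.
  exists (Q * 'X^(\sum_(j | j != i) m j)).
  by rewrite tofracM tofracXn -eQ -mulrA -exprD [in LHS](bigD1 i).
have PX i M : (N <= M)%N -> is_polynomial (chart_coef x^-1 P`_i * x ^+ M).
  move=> NM; have [iP|Pi] := ltnP i (size P); last first.
    by exists 0; rewrite nth_default // rmorph0 mul0r tofrac0.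
  have [Q eQ] := PN (Ordinal iP); exists (Q * 'X^(M - N)).
  by rewrite tofracM tofracXn -eQ -mulrA -exprD subnKC.
exists N; set d := (size P).-1.
have sP : size P = d.+1 by rewrite prednK // size_poly_gt0 monic_neq0.
have Pd : P`_d = 1 by move/monicP: monP.
pose Q : {poly L} := \poly_(j < d.+1)
  of_ratfun h (chart_coef x^-1 P`_j * x ^+ (N * (d - j))).
rewrite /chart_fin chartE; apply: (@integral_root_monic _ _ _ _ Q).
- rewrite monicE lead_coef_poly //= Pd subnn muln0 rmorph1 mul1r rmorph1 //.
  exact: oner_neq0.
- suff : Q.[of_ratfun h (x ^+ N) * z] =
      of_ratfun h (x ^+ (N * d)) * (map_poly (chart_map h x^-1) P).[z].
    by rewrite Pz0 mulr0 => Q0; apply/eqP.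
  rewrite horner_poly horner_coef size_map_poly_id0; last first.
    by rewrite (monicP monP) rmorph1 oner_neq0.
  rewrite sP mulr_sumr; apply: eq_bigr => i _.
  rewrite coef_map /= exprMn -(rmorphXn (@of_ratfun K h)) !mulrA.
  rewrite -!(rmorphM (@of_ratfun K h)) /=; congr (of_ratfun _ _ * _).
  have -> : x ^+ (N * d) = x ^+ (N * (d - i)) * x ^+ N ^+ i.
    by rewrite -exprM -exprD -mulnDr subnK // -ltnS.
  by rewrite -mulrA mulrC.
apply/integral_poly => i; rewrite coef_poly; case: ifP => [id|_]; last exact: integral0.
apply: chart_fin_polynomial.
have [->|nid] := eqVneq i d.
  by exists 1; rewrite Pd subnn muln0 rmorph1 mul1r tofrac1.
by apply: PX; rewrite leq_pmulr // subn_gt0 ltn_neqAle nid -ltnS.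
Qed.

Lemma chart_inf_laurent z i : chart_inf z -> exists d, deg_le (coord z i) d.
Proof.
case/chart_inf_fin => N zN.
have [ip|pi] := ltnP i p; last first.
  by exists 0; rewrite (coord_default charK) //; apply: deg_le0.
have /(_ _ ip) [P eP] := (chart_finP charK _).1 zN.
exists ((size P)%:Z - N%:Z - 1), N, P; split; last by lia.
by rewrite -eP of_ratfunE coordZ mulrC.
Qed.

Lemma chart_inf_bounded z : chart_inf z ->
  exists M : nat, forall N, deg_le (coord (z ^+ N) 0) M%:Z.
Proof.
move=> zi; have [d dz] := integral_coord_pow zi.
have /fin_all_exists [m mP] (j : 'I_d) : exists m : nat, deg_le (coord (z ^+ j) 0) m%:Z.
  have [e ze] := chart_inf_laurent 0 (chart_infX j zi).
  by exists `|e|%N; apply: deg_leW ze; lia.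
exists (\max_j m j)%N => N; have [c ->] := dz N; apply: deg_le_sum => j _.
rewrite -[Posz _]add0r; apply: deg_leM; first exact: chart_coef_Vx_deg.
by apply: deg_leW (mP j); rewrite lez_nat; apply: (leq_bigmax j).
Qed.

(** The weights p deg z_i + i n are distinct modulo p, because n is prime to p, so
    one index j dominates.  The constant coordinate of z^(p^(M+1)) then has degree
    exactly p^M times the weight of j; as the degrees of the constant coordinates of all
    powers of z are bounded, that weight is not positive. *)
Lemma chart_inf_deg z i : chart_inf z -> (i < p)%N ->
  exists2 e, deg_le (coord z i) e & p%:Z * e + (i * n)%N%:Z <= 0.
Proof.
move=> zi ip.
have /fin_all_exists [d dP] (j : 'I_p) : exists d, 
    coord z j != 0 -> has_deg (coord z j) d.
  have [e ze] := chart_inf_laurent j zi.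
  have [_|z0] := eqVneq (coord z j) 0; first by exists 0.
  by have [d zd _] := deg_le_has_deg ze z0; exists d.
pose w (j : 'I_p) : int := p%:Z * d j + (j * n)%N%:Z.
(* Equal weights force p to divide (j1 - j2) n; the truncated difference makes this vacuous for j1 <= j2. *)
have w_dvd j1 j2 : w j1 = w j2 -> (p %| j1 - j2)%N.
  rewrite /w => ew; rewrite -(@Gauss_dvdl _ _ n) //.
  have [j12|/ltnW j21] := leqP j1 j2; first by rewrite (eqP j12) mul0n dvdn0.
  rewrite -[X in (X %| _)%N]/(`|p%:Z|%N) -[X in (_ %| X)%N]/(`|((j1 - j2) * n)%N%:Z|%N).
  rewrite -dvdzE; apply/dvdzP; exists (d j2 - d j1).
  have : (j2 * n <= j1 * n)%N by rewrite leq_mul2r j21 orbT.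
  rewrite mulnBl; move: ew; move: (j1 * n)%N (j2 * n)%N => a b; lia.
have w_inj j1 j2 : w j1 = w j2 -> j1 = j2.
  move=> ew; apply/val_inj/eqP => /=; have := ltn_ord j1; have := ltn_ord j2.
  have := w_dvd _ _ (esym ew); have := w_dvd _ _ ew.
  move: (val j1) (val j2) => a b /=.
  have le_dvd c e : (p %| c - e)%N -> (c < p)%N -> (c <= e)%N.
    move=> pce cp; rewrite -subn_eq0; case: (c - e)%N (leq_subr e c) pce => // k kc.
    by move/dvdn_leq => /(_ isT) pk; lia.
  by move=> ab ba bp ap; rewrite eqn_leq; apply/andP; split; apply: le_dvd.
have [zi0|zi0] := eqVneq (coord z i) 0.
  exists (- (i * n)%N%:Z); first by rewrite zi0; apply: deg_le0.
  nia.
case: (@arg_maxP _ _ _ (Ordinal ip) (fun j => coord z j != 0) w zi0) => j z0 wmax.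
suff wj : w j <= 0.
  exists (d (Ordinal ip)); first exact: (has_deg_le (dP (Ordinal ip) zi0)).
  exact: le_trans (wmax (Ordinal ip) zi0) wj.
have [M zM] := chart_inf_bounded zi.
rewrite leNgt; apply/negP => wj_gt0.
have deg_term (j' : 'I_p) : coord z j' != 0 ->
    has_deg (coord z j' ^+ (p ^ M.+1) * F_ M.+1 ^+ j') (w j' * (p ^ M)%N%:Z).
  move=> zj'; rewrite /w mulrDl.
  have := has_degM (has_degX (p ^ M.+1) (dP _ zj')) (has_degX j' (has_deg_frob_shift M)).
  congr has_deg; rewrite !pmulrn !mulrzz expnS !PoszM; ring.
have ww (j' : 'I_p) : coord z j' != 0 -> j' != j -> w j' <= w j - 1.
  move=> zj' jj'; have le := wmax j' zj'.
  have : w j' != w j by apply: contra_neq jj' => /w_inj.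
  move: le; lia.
(* The exponent M.+1 is large enough because M < p ^ M. *)
have := zM (p ^ M.+1)%N; rewrite (coord0_frob charK) (bigD1 j) //=.
have pM := ltn_expl M p_gt1.
move/(has_deg_le_leq (has_degDl (d' := w j * (p ^ M)%N%:Z - 1) (deg_term j z0) _ _)).
move=> le; suff : w j * (p ^ M)%N%:Z <= M by nia.
apply: le; last by lia.
apply: deg_le_sum => j' jj'; have [->|zj'] := eqVneq (coord z j') 0.
  by rewrite expr0n expn_eq0 (gtn_eqF p_gt0) mul0r; apply: deg_le0.
apply: deg_leW (has_deg_le (deg_term j' zj')).
have := ww j' zj' jj'; nia.
Qed.

End Infinity.

(** * The genus *)

Section GenusUnique.
Variables (K : fieldType) (h : {poly {poly K}}).
Local Notation L := (fun_field h).

Lemma of_constE c (s : {fraction {poly K}}) : of_const h c = of_ratfun h (chart_coef s c%:P).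
Proof. by rewrite /of_const /chart_coef map_polyC hornerC. Qed.

Lemma of_const_zmod : zmod_morphism (of_const h).
Proof. by move=> a b; rewrite /of_const rmorphB (rmorphB (@of_ratfun K h)). Qed.

Lemma of_const_monoid : monoid_morphism (of_const h).
Proof.
split=> [|a b]; rewrite /of_const ?rmorph1 ?(rmorph1 (@of_ratfun K h)) //.
by rewrite rmorphM (rmorphM (@of_ratfun K h)).
Qed.
HB.instance Definition _ := GRing.isZmodMorphism.Build K L (of_const h) of_const_zmod.
HB.instance Definition _ := GRing.isMonoidMorphism.Build K L (of_const h) of_const_monoid.

Lemma chart_const s c : chart s (of_const h c).
Proof. by rewrite (of_constE c s); apply: chart_ratfun. Qed.

Lemma chart_sum0 : chart_sum (0 : L).
Proof.
exists 0, 0; split; rewrite ?addr0 //.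
  by rewrite /chart_fin chartE; apply: integral0.
by rewrite /chart_inf chartE; apply: integral0.
Qed.

Lemma chart_sumD (u v : L) : chart_sum u -> chart_sum v -> chart_sum (u + v).
Proof.
move=> [a [b [a1 b1 ->]]] [c [d [c1 d1 ->]]]; exists (a + c), (b + d).
split; last by rewrite addrACA.
  by move: a1 c1; rewrite /chart_fin !chartE; apply: integral_add.
by move: b1 d1; rewrite /chart_inf !chartE; apply: integral_add.
Qed.

Lemma chart_sumZ c (u : L) : chart_sum u -> chart_sum (of_const h c * u).
Proof.
move=> [a [b [a1 b1 ->]]]; exists (of_const h c * a), (of_const h c * b).
split; last by rewrite mulrDr.
  move: a1 (chart_const (ratfun_x K) c); rewrite /chart_fin !chartE => a1 c1.
  exact: integral_mul.
move: b1 (chart_const (ratfun_x K)^-1 c); rewrite /chart_inf !chartE => b1 c1.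
exact: integral_mul.
Qed.

Lemma chart_sum_sum I (r : seq I) (P : pred I) (F : I -> L) :
  (forall i, P i -> chart_sum (F i)) -> chart_sum (\sum_(i <- r | P i) F i).
Proof.
move=> SF; apply: (big_ind (@chart_sum K h)) => //; first exact: chart_sum0.
exact: chart_sumD.
Qed.

(** Two families that span modulo chart_sum are related by matrices A and B, and
    independence of the second forces A B = 1. *)
Lemma genus_leq g g' : genus h g -> genus h g' -> (g' <= g)%N.
Proof.
move=> [e [e_ov e_span _]] [e' [e'_ov e'_span e'_free]].
have /fin_all_exists [A AP] j := e_span _ (e'_ov j).
have /fin_all_exists [B BP] i := e'_span _ (e_ov i).
apply: (@mulmx1_min _ _ _ (\matrix_(j, i) A j i) (\matrix_(i, k) B i k)).
apply/matrixP => j k; rewrite !mxE; apply/eqP; rewrite eq_sym -subr_eq0.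
have -> : \sum_i (\matrix_(j, i) A j i) j i * (\matrix_(i, k) B i k) i k =
    \sum_i A j i * B i k by apply: eq_bigr => i _; rewrite !mxE.
apply/eqP; move: k; apply: e'_free.
have -> : \sum_k of_const h ((j == k)%:R - \sum_i A j i * B i k) * e' k =
    (e' j - \sum_i of_const h (A j i) * e i) +
    \sum_i of_const h (A j i) * (e i - \sum_k of_const h (B i k) * e' k).
  under [X in _ = _ + X]eq_bigr do rewrite mulrBr mulr_sumr.
  rewrite sumrB addrA subrK exchange_big /=.
  under eq_bigr do rewrite rmorphB rmorph_nat mulrBl.
  rewrite sumrB; congr (_ - _).
    rewrite (bigD1 j) //= eqxx mul1r big1 ?addr0 // => k kj.
    by rewrite eq_sym (negPf kj) mul0r.
  apply: eq_bigr => k _; rewrite rmorph_sum mulr_suml; apply: eq_bigr => i _.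
  by rewrite mulrA -(rmorphM (of_const h)).
apply: chart_sumD; first exact: AP.
by apply: chart_sum_sum => i _; apply: chart_sumZ; apply: BP.
Qed.

Lemma genus_unique g g' : genus h g -> genus h g' -> g = g'.
Proof. by move=> hg hg'; apply/eqP; rewrite eqn_leq !genus_leq. Qed.

Lemma genus_basis (T : finType) (e : T -> L) :
  (forall t, overlap (e t)) ->
  (forall z : L, overlap z -> exists c : T -> K,
     chart_sum (z - \sum_t of_const h (c t) * e t)) ->
  (forall c : T -> K, chart_sum (\sum_t of_const h (c t) * e t) -> forall t, c t = 0) ->
  genus h #|T|.
Proof.
move=> e_ov e_span e_free; exists (e \o enum_val); split.
- by move=> i; apply: e_ov.
- move=> z /e_span [c zc]; exists (c \o enum_val); move: zc.
  by rewrite (big_enum_val (A := T) (fun t => of_const h (c t) * e t)).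
move=> c; pose c' t := c (enum_rank t) => cS i.
rewrite -[i]enum_valK; apply: (e_free c').
rewrite (big_enum_val (A := T) (fun t => of_const h (c' t) * e t)) /c'.
by move: cS; congr chart_sum; apply: eq_bigr => k _; rewrite /= enum_valK.
Qed.

End GenusUnique.

Section LaurentTails.
Variable K : fieldType.
Local Notation E := {fraction {poly K}}.
Local Notation "P %:F" := (@FracField.tofrac {poly K} P) (at level 1).
Local Notation x := (ratfun_x K).
Local Notation const := (@ratfun_const K).

Lemma laurent_leading (e : E) d : deg_le e (- d%:Z) ->
  exists g : K, deg_le (e - const g * x^-1 ^+ d) (- d.+1%:Z).
Proof.
case=> N [P [eP sP]]; pose Q := P * 'X^d; exists Q`_N.
have x0 := ratfun_x_neq0 K.
have xd : x^-1 ^+ d * x ^+ (N + d) = x ^+ N by exact: expVD_cancel.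
have eX : (e - const Q`_N * x^-1 ^+ d) * x ^+ (N + d) = (Q - Q`_N *: 'X^N)%:F.
  rewrite mulrBl -mulrA xd exprD mulrA eP tofracB tofracM -mul_polyC tofracM.
  by rewrite !tofracXn.
exists (N + d)%N, (Q - Q`_N *: 'X^N); split=> //.
suff : (size (Q - Q`_N *: 'X^N)%R <= N)%N.
  by move: (size _) => s; lia.
apply/leq_sizeP => j; rewrite coefB coefZ coefXn leq_eqVlt => /orP[/eqP <-|Nj].
  by rewrite eqxx mulr1 subrr.
rewrite gtn_eqF // mulr0 subr0 coefMXn; case: ltnP => // dj.
by rewrite nth_default //; move: sP; move: (size P) => s; lia.
Qed.

Lemma laurent_split (e : E) d c : deg_le e d ->
  exists A (g : 'I_c -> K) B, [/\ is_polynomial A, deg_le B (- c.+1%:Z) &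
    e = A + \sum_(j < c) const (g j) * x^-1 ^+ j.+1 + B].
Proof.
move=> ed; elim: c => [|c [A [g [B [PA dB eE]]]]].
  case: ed => N [P [eP _]]; exists (drop_poly N P)%:F, (fun=> 0), ((take_poly N P)%:F / x ^+ N).
  have xN : x ^+ N != 0 by rewrite expf_neq0 ?ratfun_x_neq0.
  split; first by exists (drop_poly N P).
    exists N, (take_poly N P); rewrite divfK //; split=> //.
    by have := size_take_poly N P; move: (size _) => s; lia.
  rewrite big_ord0 addr0; apply: (mulIf xN); rewrite mulrDl divfK // eP.
  by rewrite -[in LHS](poly_take_drop N P) tofracD tofracM tofracXn addrC.
have [g0 dB'] := laurent_leading dB.
exists A, (fun j => if unlift ord_max j is Some k then g k else g0), (B - const g0 * x^-1 ^+ c.+1).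
split=> //; rewrite big_ord_recr /= unlift_none.
under eq_bigr => j _.
  have -> : widen_ord (leqnSn c) j = lift ord_max j.
    by apply: val_inj; rewrite /= /bump leqNgt ltn_ord.
  by rewrite liftK; over.
by rewrite eE /= -!addrA; congr (_ + (_ + _)); rewrite addrCA subrr addr0.
Qed.

(** Multiplied by x^c, the difference of both sides is a polynomial of negative degree. *)
Lemma laurent_tail_free c (g : 'I_c -> K) (A B : E) :
  is_polynomial A -> deg_le B (- c.+1%:Z) ->
  \sum_(j < c) const (g j) * x^-1 ^+ j.+1 = A + B -> forall j, g j = 0.
Proof.
move=> [P ->] dB eAB.
have x0 := ratfun_x_neq0 K.
pose G := \sum_(j < c) g j *: 'X^(c - j.+1).
have GE : (G - P * 'X^c)%:F = B * x ^+ c.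
  rewrite tofracB tofracM tofracXn -[B](addKr P%:F) -eAB mulrDl mulNr [RHS]addrC.
  congr (_ - _); rewrite /G rmorph_sum mulr_suml; apply: eq_bigr => j _.
  rewrite /= -mul_polyC tofracM tofracXn -mulrA; congr (_ * _).
  by rewrite -/x -(expVD_cancel (c - j.+1) j.+1 x0) subnK.
have G0 : G - P * 'X^c = 0.
  apply: (polynomial_neg_deg (d := -1)) => //; rewrite GE.
  have := deg_leM dB (has_deg_le (has_degX c (has_deg_x K))).
  by apply: deg_leW; rewrite pmulrn intz; lia.
move=> j; have /(congr1 (fun Q : {poly K} => Q`_(c - j.+1))) := G0.
rewrite coef0 coefB coefMXn ltn_subrL /= (leq_ltn_trans _ (ltn_ord j)) // subr0.
rewrite coef_sum (bigD1 j) //= coefZ coefXn eqxx mulr1 big1 ?addr0 // => k kj.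
rewrite coefZ coefXn; case: eqP => [ekj|]; last by rewrite mulr0.
have jc := ltn_ord j; have kc := ltn_ord k.
by move/eqP: kj; case; apply: val_inj => /=; lia.
Qed.

End LaurentTails.

Section Genus.
Variables (K : fieldType) (p n : nat) (f : {poly K}).
Hypothesis charK : p \in [pchar K].
Hypothesis size_f : size f = n.+1.
Hypothesis cop_pn : coprime p n.
Local Notation E := {fraction {poly K}}.
Local Notation "P %:F" := (@FracField.tofrac {poly K} P) (at level 1).
Local Notation h := (artin_schreier p f).
Local Notation L := (fun_field h).
Local Notation x := (ratfun_x K).
Local Notation y := (gen_y p f).
Local Notation coord z i := ((polyn (z : L))`_i).

Let p_pr : prime p. Proof. exact: pcharf_prime charK. Qed.
Let p_gt1 : (1 < p)%N. Proof. exact: prime_gt1. Qed.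
Let p_gt0 : (0 < p)%N. Proof. exact: prime_gt0. Qed.

Local Notation gap := (fun i : 'I_p => 'I_((i * n) %/ p)).

(** The monomials x^-(j+1) y^i that lie in neither chart: j + 1 <= i n / p. *)
Definition gap_basis (t : {i : 'I_p & gap i}) : L :=
  x^-1 ^+ (tagged t).+1 *: y ^+ tag t.

Lemma coord_gap_basis_sum (c : {i : 'I_p & gap i} -> K) (i : 'I_p) :
  coord (\sum_t of_const h (c t) * gap_basis t) i =
  \sum_(j < (i * n) %/ p) ratfun_const (c (Tagged gap j)) * x^-1 ^+ j.+1.
Proof.
have -> : \sum_t of_const h (c t) * gap_basis t = \sum_(i < p)
    (\sum_(j < (i * n) %/ p) ratfun_const (c (Tagged gap j)) * x^-1 ^+ j.+1) *: y ^+ i.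
  under [RHS]eq_bigr do rewrite scaler_suml.
  rewrite [RHS]sig_big_dep /=.
  apply: eq_bigr => -[i' j] _ /=; rewrite /gap_basis /of_const of_ratfunE scalerA.
  by [].
exact: coord_sum.
Qed.

Lemma overlapP (z : L) : overlap z <-> forall i : 'I_p, exists d, deg_le (coord z i) d.
Proof.
split=> [[N zN] i|dz].
  move: zN; rewrite -(rmorphXn (@of_ratfun K h)) of_ratfunE => /(chart_finP charK).
  case/(_ i (ltn_ord i)) => P; rewrite coordZ mulrC => eP.
  by exists ((size P)%:Z - N%:Z - 1), N, P; split=> //; lia.
have /fin_all_exists [N NP] (i : 'I_p) : exists N, is_polynomial (coord z i * x ^+ N).
  by have [d [N [P [eP _]]]] := dz i; exists N, P.
exists (\sum_i N i)%N; rewrite -(rmorphXn (@of_ratfun K h)) of_ratfunE.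
apply/(chart_finP charK) => i ip; rewrite coordZ mulrC.
have [P eP] := NP (Ordinal ip); rewrite (bigD1 (Ordinal ip)) //= exprD mulrA eP.
by exists (P * 'X^(\sum_(j < p | j != Ordinal ip) N j)); rewrite tofracM tofracXn.
Qed.

(** Each coordinate of an element of the overlap splits into a polynomial, which
    belongs to the finite chart, a tail of degree below - i n / p, which belongs to the
    chart at infinity, and finitely many monomials in between. *)
Lemma genus_artin_schreier : genus h (\sum_(i < p) (i * n) %/ p).
Proof.
have -> : (\sum_(i < p) (i * n) %/ p)%N = #|{: {i : 'I_p & gap i}}|.
  rewrite card_tagged sumnE big_map big_enum /=.
  by apply: eq_bigr => i _; rewrite card_ord.
apply: (genus_basis (e := gap_basis)).
- move=> t; apply/overlapP => i; rewrite coordZ coord_yX //.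
  exists (- (tagged t).+1%:Z + 0); apply: deg_leM.
    by have := has_degX (tagged t).+1 (has_deg_Vx K); rewrite mulNrn => /has_deg_le; rewrite pmulrn intz.
  rewrite -(rmorph_nat (@FracField.tofrac {poly K})).
  apply: (deg_leW _ (deg_le_poly _)); rewrite -polyC_natr size_polyC.
  by case: eqP.
- move=> z /overlapP dz.
  have /fin_all_exists [gg ggP] (i : 'I_p) : exists AgB : E * ('I_((i * n) %/ p) -> K) * E,
      [/\ is_polynomial AgB.1.1, deg_le AgB.2 (- ((i * n) %/ p).+1%:Z) &
    coord z i = AgB.1.1 + \sum_(j < (i * n) %/ p) ratfun_const (AgB.1.2 j) * x^-1 ^+ j.+1 + AgB.2].
    have [d dzi] := dz i.
    by have [A [g [B [PA dB eAB]]]] := laurent_split ((i * n) %/ p) dzi; exists (A, g, B).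
  exists (fun t => (gg (tag t)).1.2 (tagged t)).
  exists (\sum_(i < p) (gg i).1.1 *: y ^+ i), (\sum_(i < p) (gg i).2 *: y ^+ i); split.
  - apply/(chart_finP charK) => i ip.
    by rewrite (coord_sum f charK _ (Ordinal ip)); have [] := ggP (Ordinal ip).
  - apply: chart_inf_sum => i _; have [_ dB _] := ggP i.
    apply: (chart_inf_monomial charK size_f cop_pn dB).
    have := ltn_ceil (i * n) p_gt0; move: ((i * n) %/ p)%N (i * n)%N => a b; lia.
  apply: (coord_eqP charK) => i ip; have [_ _ ez] := ggP (Ordinal ip).
  rewrite coordD coordN coordD (coord_gap_basis_sum _ (Ordinal ip)).
  rewrite !(coord_sum f charK _ (Ordinal ip)) [coord z i]ez /=.
  by rewrite addrAC addrK.
move=> c [u [v [uc vc euv]]] [i j].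
have [e ve le0] := chart_inf_deg charK size_f cop_pn vc (ltn_ord i).
have dv : deg_le (coord v i) (- ((i * n) %/ p).+1%:Z).
  apply: deg_leW ve; have := divn_eq (i * n) p.
  have : (0 < (i * n) %% p)%N.
    rewrite lt0n -/(_ %| _)%N Gauss_dvdl // gtnNdvd // lt0n.
    by apply: contraTneq (leq_ltn_trans (leq0n j) (ltn_ord j)) => ->; rewrite mul0n div0n.
  move: le0; move: ((i * n) %/ p)%N ((i * n) %% p)%N (i * n)%N => a b d; nia.
apply: (laurent_tail_free (g := fun j => c (Tagged gap (j : gap i)))
          ((chart_finP charK _).1 uc i (ltn_ord i)) dv).
by rewrite -coord_gap_basis_sum euv coordD.
Qed.

End Genus.

(** * Rational points *)

Lemma card_eq_finType (T : finType) (U : Type) (A : set U) (f : T -> U) :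
  injective f -> (forall u, A u <-> exists t, u = f t) ->
  card_eq A (fun k => (k < #|T|)%N).
Proof.
move=> f_inj AE.
have -> : A = image setT (f \o @enum_val T predT).
  apply/seteqP; split=> [u /AE [t ->]|_ [i _ <-]]; last by apply/AE; exists (enum_val i).
  by exists (enum_rank t); rewrite //= enum_rankK.
apply: (@card_eq_trans _ _ _ _ [set: 'I_#|T|]); last by rewrite card_eq_sym; apply: card_II.
by apply: inj_card_eq => i j _ _ /f_inj /enum_val_inj.
Qed.

Section RationalPoints.
Variables (K : fieldType) (h : {poly {poly K}}) (s : {fraction {poly K}}).
Variable M : set (fun_field h).
Hypothesis ptM : rational_point (chart s) M.

Lemma rational_point_chart z : M z -> chart s z.
Proof. by case: ptM => MB _ _ _ _; apply: MB. Qed.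
Lemma rational_pointD u v : M u -> M v -> M (u + v).
Proof. by case: ptM => _ _ MD _ _; apply: MD. Qed.
Lemma rational_pointM b u : chart s b -> M u -> M (b * u).
Proof. by case: ptM => _ _ _ MM _; apply: MM. Qed.
Lemma rational_pointN u : M u -> M (- u).
Proof.
move=> Mu; rewrite -mulN1r; apply: rational_pointM Mu.
by have := chart_const h s (-1); rewrite rmorphN1.
Qed.
Lemma rational_pointB u v : M u -> M v -> M (u - v).
Proof. by move=> Mu Mv; apply: rational_pointD => //; apply: rational_pointN. Qed.

Lemma rational_point_residue b : chart s b -> exists c, M (b - of_const h c).
Proof. by case: ptM => _ _ _ _ MR /MR [c [Mc _]]; exists c. Qed.

(** The value of 0 at a rational point is unique, and both 0 and - c qualify. *)
Lemma rational_point_const c : M (of_const h c) -> c = 0.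
Proof.
move=> Mc; case: ptM => _ M0 _ _ /(_ 0).
have B0 : chart s (0 : fun_field h) by have := chart_const h s 0; rewrite rmorph0.
case/(_ B0) => d [_ dU].
have -> : c = - d.
  by apply/eqP; rewrite -eqr_oppLR; apply/eqP/esym/dU; rewrite rmorphN sub0r opprK.
by apply/eqP; rewrite oppr_eq0; apply/eqP/dU; rewrite rmorph0 subr0.
Qed.

Lemma rational_pointX z k : chart s z -> (0 < k)%N -> M z -> M (z ^+ k).
Proof.
case: k => // k zB _ Mz; rewrite exprSr; apply: rational_pointM => //.
by move: zB; rewrite !chartE; apply: integral_exp.
Qed.

End RationalPoints.

Section FinitePoints.
Variables (K : finFieldType) (p : nat) (f : {poly K}).
Hypothesis charK : p \in [pchar K].
Local Notation E := {fraction {poly K}}.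
Local Notation "P %:F" := (@FracField.tofrac {poly K} P) (at level 1).
Local Notation h := (artin_schreier p f).
Local Notation L := (fun_field h).
Local Notation x := (ratfun_x K).
Local Notation y := (gen_y p f).
Local Notation coord z i := ((polyn (z : L))`_i).

(** The evaluation of a polynomial in x and y in the function field; its range is the
    finite chart. *)
Definition lift_poly : {poly {poly K}} -> L :=
  inL p f \o map_poly (@FracField.tofrac {poly K}).
HB.instance Definition _ := GRing.RMorphism.on lift_poly.

Lemma lift_polyX : lift_poly 'X = y.
Proof. by rewrite /lift_poly /= map_polyX. Qed.
Lemma lift_polyC (P : {poly K}) : lift_poly P%:P = of_ratfun h P%:F.
Proof. by rewrite /lift_poly /= map_polyC inLC. Qed.
Lemma lift_poly_const c : lift_poly c%:P%:P = of_const h c.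
Proof. exact: lift_polyC. Qed.
Lemma lift_poly_h : lift_poly h = 0.
Proof.
rewrite -[LHS]/(lift_poly ('X^p - 'X - f%:P)) !(rmorphB lift_poly) (rmorphXn lift_poly) /=.
by rewrite lift_polyX lift_polyC (yp f charK) addrAC addrK subrr.
Qed.

Lemma chart_finE (z : L) : chart_fin z <-> exists Q, z = lift_poly Q.
Proof.
split=> [/(chart_finP charK) zP|[Q ->]]; last first.
  rewrite /lift_poly /= inLE /chart_fin chartE; apply: integral_sum => i _.
  rewrite -of_ratfunE; apply: integral_mul; last exact/integral_exp/(chart_fin_y _ charK).
  by rewrite coef_map; apply: (chart_fin_polynomial h); exists Q`_i.
have /fin_all_exists [P eP] (i : 'I_p) := zP i (ltn_ord i).
exists (\sum_(i < p) (P i)%:P * 'X^i); rewrite rmorph_sum [LHS](coordE charK).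
apply: eq_bigr => i _.
by rewrite rmorphM rmorphXn /= lift_polyX lift_polyC -eP of_ratfunE.
Qed.

(** The remainder of Q by the monic h maps to 0 and is short enough to be its own
    coordinate vector. *)
Lemma lift_poly_eq0 Q : lift_poly Q = 0 -> exists W, Q = W * h.
Proof.
move=> Q0; have mon_h : h \is monic := monic_artin_schreier charK f.
exists (Pdiv.Ring.rdivp Q h); move: (Pdiv.RingMonic.rdivp_eq mon_h Q).
set R := Pdiv.Ring.rmodp Q h => eQ; suff R0 : R = 0 by rewrite R0 addr0 in eQ.
have sR : (size R <= p)%N.
  by rewrite -ltnS -[p.+1](size_artin_schreier charK f) -/h Pdiv.Ring.ltn_rmodpN0 // monic_neq0.
have R0 : lift_poly R = 0.
  by move: Q0; rewrite eQ rmorphD rmorphM /= lift_poly_h mulr0 add0r.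
apply/polyP => i; rewrite coef0; apply/eqP; rewrite -tofrac_eq0 -coef_map.
have sM : (size (map_poly (@FracField.tofrac {poly K}) R) <= p)%N.
  exact: leq_trans (size_poly _ _) sR.
by rewrite /= -(inL_small f charK sM) -[inL _ _ _]/(lift_poly R) R0 coef0.
Qed.

Definition eval_at (ab : K * K) (Q : {poly {poly K}}) : K := Q.[ab.2%:P].[ab.1].

Definition on_curve (ab : K * K) := ab.2 ^+ p - ab.2 == f.[ab.1].

Lemma eval_at_h ab : (eval_at ab h == 0) = on_curve ab.
Proof. by rewrite /eval_at /artin_schreier !hornerE subr_eq0. Qed.

(** Being the image of a polynomial that vanishes at the point is well defined by
    eval_at_lift_poly. *)
Definition affine_point ab : set L := fun z => exists Q, z = lift_poly Q /\ eval_at ab Q = 0.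

Lemma eval_atD ab P Q : eval_at ab (P + Q) = eval_at ab P + eval_at ab Q.
Proof. by rewrite /eval_at !hornerD. Qed.
Lemma eval_atB ab P Q : eval_at ab (P - Q) = eval_at ab P - eval_at ab Q.
Proof. by rewrite /eval_at !hornerD !hornerN. Qed.
Lemma eval_atM ab P Q : eval_at ab (P * Q) = eval_at ab P * eval_at ab Q.
Proof. by rewrite /eval_at !hornerM. Qed.
Lemma eval_atC ab c : eval_at ab c%:P%:P = c.
Proof. by rewrite /eval_at !hornerC. Qed.

Lemma eval_at_lift_poly ab P Q : on_curve ab -> lift_poly P = lift_poly Q -> eval_at ab P = eval_at ab Q.
Proof.
move=> abC /eqP; rewrite -subr_eq0 -(rmorphB lift_poly) => /eqP /lift_poly_eq0 [W eW].
apply/eqP; rewrite -subr_eq0 -eval_atB eW eval_atM mulf_eq0.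
by move: abC; rewrite -eval_at_h => ->; rewrite orbT.
Qed.

Lemma affine_pointP ab : on_curve ab -> rational_point (@chart_fin K h) (affine_point ab).
Proof.
move=> abC; split.
- by move=> z [Q [-> _]]; apply/chart_finE; exists Q.
- by exists 0; rewrite (rmorph0 lift_poly) /eval_at !horner0.
- move=> _ _ [P [-> P0]] [Q [-> Q0]]; exists (P + Q).
  by rewrite (rmorphD lift_poly) eval_atD P0 Q0 addr0.
- move=> b _ /chart_finE [P ->] [Q [-> Q0]]; exists (P * Q).
  by rewrite (rmorphM lift_poly) eval_atM Q0 mulr0.
move=> _ /chart_finE [Q ->]; exists (eval_at ab Q); split.
  exists (Q - (eval_at ab Q)%:P%:P); rewrite (rmorphB lift_poly) /= lift_poly_const; split=> //.
  by rewrite eval_atB eval_atC subrr.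
move=> c [P [eP P0]]; apply/eqP; rewrite -subr_eq0 -(eval_atC ab c) -eval_atB; apply/eqP.
by rewrite -P0; apply: eval_at_lift_poly => //; rewrite -eP (rmorphB lift_poly) /= lift_poly_const.
Qed.

Lemma eval_at_factor ab (Q : {poly {poly K}}) : exists S R,
  Q - (eval_at ab Q)%:P%:P = S * ('X - ab.2%:P%:P) + R%:P * ('X - ab.1%:P)%:P.
Proof.
have /factor_theorem [S eS] : root (Q - Q.[ab.2%:P]%:P) ab.2%:P.
  by rewrite rootE !hornerE subrr.
have /factor_theorem [R eR] : root (Q.[ab.2%:P] - (eval_at ab Q)%:P) ab.1.
  by rewrite rootE !hornerE subrr.
exists S, R; rewrite -eS -polyCM -eR polyCB addrA subrK.
by [].
Qed.

(** The residues a and b of x and y determine the residue of every polynomial in x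
    and y; the residue of h itself is 0, so (a, b) lies on the curve. *)
Lemma rational_point_fin (M : set L) : rational_point (@chart_fin K h) M ->
  exists2 ab, on_curve ab & M = affine_point ab.
Proof.
move=> ptM.
have xB : chart_fin (of_ratfun h x) by apply: chart_fin_polynomial; exists 'X.
have [a Ma] := rational_point_residue ptM xB.
have [b Mb] := rational_point_residue ptM (chart_fin_y f charK).
have MQ Q : M (lift_poly Q - of_const h (eval_at (a, b) Q)).
  have [S [R eQ]] := eval_at_factor (a, b) Q.
  rewrite -lift_poly_const -(rmorphB lift_poly) eQ (rmorphD lift_poly) !(rmorphM lift_poly); apply: (rational_pointD ptM).
    apply: (rational_pointM ptM); first by apply/chart_finE; exists S.
    by rewrite (rmorphB lift_poly) /= lift_polyX lift_poly_const.
  apply: (rational_pointM ptM); first by apply/chart_finE; exists R%:P.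
  by rewrite polyCB (rmorphB lift_poly) /= lift_polyC lift_poly_const.
exists (a, b).
  rewrite -eval_at_h; apply/eqP/(rational_point_const ptM).
  have := MQ h; rewrite lift_poly_h sub0r => /(rational_pointN ptM).
  by rewrite opprK.
apply/seteqP; split=> [z Mz|z [Q [-> Q0]]]; last by have := MQ Q; rewrite Q0 rmorph0 subr0.
have /chart_finE [Q zQ] := rational_point_chart ptM Mz.
exists Q; split=> //; apply: (rational_point_const ptM).
have := rational_pointB ptM Mz (MQ Q); rewrite zQ opprB addrC subrK; exact.
Qed.

Lemma affine_point_inj ab cd : on_curve ab -> on_curve cd ->
  affine_point ab = affine_point cd -> ab = cd.
Proof.
move=> abC cdC eM.
have H Q : eval_at ab Q = 0 -> eval_at cd Q = 0.
  move=> Q0; have : affine_point cd (lift_poly Q) by rewrite -eM; exists Q.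
  by case=> P [eP P0]; rewrite (eval_at_lift_poly cdC eP).
have e1 := H ('X - ab.2%:P%:P); have e2 := H ('X - ab.1%:P)%:P.
move: e1 e2; rewrite /eval_at !hornerE !subrr => /(_ erefl) e1 /(_ erefl) e2.
move/eqP: e1; move/eqP: e2; rewrite !subr_eq0.
by case: (ab) (cd) => a b [c d] /= /eqP -> /eqP ->.
Qed.

Lemma card_fin_points :
  card_eq (fun M : set L => rational_point (@chart_fin K h) M)
    (fun k => (k < #|[pred ab : K * K | on_curve ab]|)%N).
Proof.
have := @card_eq_finType {ab : K * K | on_curve ab} _
  (fun M : set L => rational_point (@chart_fin K h) M) (fun ab => affine_point (val ab)).
rewrite card_sig; apply.
  move=> ab cd /affine_point_inj e; apply: val_inj; apply: e; exact: valP.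
move=> M; split=> [/rational_point_fin [ab abC ->]|[ab ->]]; last exact/affine_pointP/valP.
by exists (Sub ab abC).
Qed.

End FinitePoints.

Section InfinitePoint.
Variables (K : fieldType) (p n : nat) (f : {poly K}).
Hypothesis charK : p \in [pchar K].
Hypothesis size_f : size f = n.+1.
Hypothesis cop_pn : coprime p n.
Local Notation E := {fraction {poly K}}.
Local Notation "P %:F" := (@FracField.tofrac {poly K} P) (at level 1).
Local Notation h := (artin_schreier p f).
Local Notation L := (fun_field h).
Local Notation x := (ratfun_x K).
Local Notation y := (gen_y p f).
Local Notation coord z i := ((polyn (z : L))`_i).
Local Notation u := (of_ratfun h x^-1).

Let p_pr : prime p. Proof. exact: pcharf_prime charK. Qed.
Let p_gt1 : (1 < p)%N. Proof. exact: prime_gt1. Qed.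
Let p_gt0 : (0 < p)%N. Proof. exact: prime_gt0. Qed.

(** The radical of the ideal generated by 1/x, tested on p^k-th powers so that it is
    visibly additive. *)
Definition infinite_point : set L :=
  fun z => chart_inf z /\ exists k, chart_inf (of_ratfun h x * z ^+ (p ^ k)).

Lemma chart_inf_const c : chart_inf (of_const h c).
Proof. exact: chart_const. Qed.

Lemma infinite_pointD z w : infinite_point z -> infinite_point w -> infinite_point (z + w).
Proof.
move=> [zB [k zk]] [wB [j wj]]; split; first exact: chart_infD.
exists (k + j)%N; rewrite (exprD_pchar (charL f charK)) mulrDr.
have up v i e : chart_inf v -> chart_inf (of_ratfun h x * v ^+ (p ^ i)) ->
    chart_inf (of_ratfun h x * v ^+ (p ^ (i + e))).
  move=> vB vi; have : (p ^ i <= p ^ (i + e))%N by rewrite leq_exp2l // leq_addr.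
  move/subnK => <-; rewrite exprD mulrCA; apply: chart_infM => //.
  exact: chart_infX.
by apply: chart_infD; [| rewrite addnC]; apply: up.
Qed.

Lemma infinite_pointM b z : chart_inf b -> infinite_point z -> infinite_point (b * z).
Proof.
move=> bB [zB [k zk]]; split; first exact: chart_infM.
exists k; rewrite exprMn mulrCA; apply: chart_infM => //; exact: chart_infX.
Qed.

Lemma infinite_point0 : infinite_point 0.
Proof.
split; first by have := chart_inf_const 0; rewrite rmorph0.
by exists 0; rewrite expr1 mulr0; have := chart_inf_const 0; rewrite rmorph0.
Qed.

Lemma infinite_point_u : infinite_point u.
Proof.
split; first by apply: chart_inf_ratfun; apply: deg_leW (has_deg_le (has_deg_Vx K)).
exists 0; rewrite expr1 -(rmorphM (@of_ratfun K h)) mulfV ?ratfun_x_neq0 //.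
by have := chart_inf_const 1; rewrite rmorph1 (rmorph1 (@of_ratfun K h)).
Qed.

Lemma infinite_point_monomial a e i : deg_le a e ->
  p%:Z * e + (i * n)%N%:Z + 1 <= 0 -> infinite_point (a *: y ^+ i).
Proof.
move=> ae le0; split; first by apply: (chart_inf_monomial charK size_f cop_pn ae); lia.
exists 1; rewrite expn1 of_ratfunE -[x]expr1.
exact: (chart_inf_pow charK size_f cop_pn ae).
Qed.

(** Only the constant coordinate can have degree 0: for 0 < i < p the weight
    p deg + i n is prime to p, hence negative. *)
Lemma infinite_point_residue b : chart_inf b -> exists c, infinite_point (b - of_const h c).
Proof.
move=> bB; have [e be le0] := chart_inf_deg charK size_f cop_pn bB p_gt0.
have [|c dc] := laurent_leading (e := coord b 0) (d := 0).
  by apply: deg_leW be; nia.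
exists c.
have -> : b - of_const h c = (coord b 0 - ratfun_const c * x^-1 ^+ 0) *: y ^+ 0 +
    \sum_(i < p | i != Ordinal p_gt0) coord b i *: y ^+ i.
  rewrite {1}[b](coordE charK) (bigD1 (Ordinal p_gt0)) //= addrAC scalerBl.
  by rewrite !expr0 mulr1.
apply: infinite_pointD; first by apply: (infinite_point_monomial dc); lia.
apply: (big_ind infinite_point); [exact: infinite_point0 | exact: infinite_pointD |].
move=> i i0; have {}i0 : (0 < i)%N by rewrite lt0n; apply: contra_neq i0 => i0; apply: val_inj.
have [d bd led] := chart_inf_deg charK size_f cop_pn bB (ltn_ord i).
apply: (infinite_point_monomial bd).
have : ~~ (p %| i * n)%N by rewrite Gauss_dvdl // gtnNdvd.
case: (eqVneq (p%:Z * d + (i * n)%N%:Z) 0) => [e0|]; last by lia.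
move=> /negP[]; rewrite -[X in (X %| _)%N]/(`|p%:Z|%N) -[X in (_ %| X)%N]/(`|(i * n)%N%:Z|%N).
by rewrite -dvdzE; apply/dvdzP; exists (- d); lia.
Qed.

Lemma infinite_point_const c : infinite_point (of_const h c) -> c = 0.
Proof.
move=> [_ [k ck]]; apply/eqP/negPn/negP => c0.
have : chart_inf (of_ratfun h x).
  have := chart_infM (chart_inf_const (c^-1 ^+ (p ^ k))) ck.
  rewrite mulrCA -(rmorphXn (of_const h)) -(rmorphM (of_const h)) -exprMn mulVf //.
  by rewrite expr1n rmorph1 mulr1.
move=> xB; have [e xe] := chart_inf_deg charK size_f cop_pn xB p_gt0.
have cx : coord (of_ratfun h x) 0 = x.
  by rewrite -[of_ratfun h x]mulr1 of_ratfunE coordZ -(expr0 y) coord_yX // mulr1.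
have := has_deg_le_leq (has_deg_x K); rewrite -{1}cx => /(_ _ xe); nia.
Qed.

Lemma infinite_pointP : rational_point (@chart_inf K h) infinite_point.
Proof.
split; [by move=> z [] | exact: infinite_point0 | exact: infinite_pointD |
        exact: infinite_pointM | ].
move=> b bB; have [c bc] := infinite_point_residue bB; exists c; split=> // d bd.
apply/eqP; rewrite -subr_eq0; apply/eqP/infinite_point_const.
rewrite rmorphB; have := infinite_pointM (chart_inf_const (-1)) bc.
rewrite rmorphN1 mulN1r opprB => /infinite_pointD /(_ bd).
by rewrite addrA subrK.
Qed.

(** A rational point that contains 1/x contains its radical, and both have residue
    field K. *)
Lemma infinite_point_unique M : rational_point (@chart_inf K h) M -> M u ->
  M = infinite_point.
Proof.
move=> ptM Mu.
have sub z : infinite_point z -> M z.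
  move=> [zB [k zk]]; have [c Mc] := rational_point_residue ptM zB.
  have pk : (0 < p ^ k)%N by rewrite expn_gt0 p_gt0.
  have Mzq : M (z ^+ (p ^ k)).
    have := rational_pointM ptM zk Mu; rewrite mulrAC -(rmorphM (@of_ratfun K h)).
    by rewrite mulfV ?ratfun_x_neq0 // (rmorph1 (@of_ratfun K h)) mul1r.
  (* z^(p^k) = x^-1 (x z^(p^k)) and (z - c)^(p^k) both lie in M. *)
  have Mcq : M (of_const h (c ^+ (p ^ k))).
    rewrite (rmorphXn (of_const h)).
    have := rational_pointX ptM (rational_point_chart ptM Mc) pk Mc.
    move/(rational_pointB ptM Mzq).
    have {1}-> : z = z - of_const h c + of_const h c by rewrite subrK.
    by rewrite (exprD_pchar (charL f charK)) addrC addKr.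
  have /eqP := rational_point_const ptM Mcq; rewrite expf_eq0 pk => /eqP c0.
  by move: Mc; rewrite c0 rmorph0 subr0.
apply/seteqP; split=> [z Mz|]; last exact: sub.
have [c zc] := infinite_point_residue (rational_point_chart ptM Mz).
have := rational_pointB ptM Mz (sub _ zc); rewrite opprB addrC subrK.
by move/(rational_point_const ptM) => c0; move: zc; rewrite c0 rmorph0 subr0.
Qed.

Lemma card_inf_points :
  card_eq (fun M : set L => rational_point (@chart_inf K h) M /\ M u)
    (fun k => (k < 1)%N).
Proof.
have := @card_eq_finType unit _
  (fun M : set L => rational_point (@chart_inf K h) M /\ M u) (fun=> infinite_point).
rewrite card_unit; apply; first by case=> -[].
move=> M; split=> [[ptM Mu]|[_ ->]]; first by exists tt; apply: infinite_point_unique.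
by split; [exact: infinite_pointP | exact: infinite_point_u].
Qed.

End InfinitePoint.

Section PointCount.
Variables (K : finFieldType) (p n : nat) (f : {poly K}).
Hypothesis charK : p \in [pchar K].
Hypothesis size_f : size f = n.+1.
Hypothesis cop_pn : coprime p n.

Lemma num_points_artin_schreier N : num_points (artin_schreier p f) N <->
  N = #|[pred ab : K * K | on_curve p f ab]|.+1.
Proof.
have fin := card_fin_points f charK.
have inf := card_inf_points charK size_f cop_pn.
split=> [[n1 [n2 [c1 c2 ->]]]|->].
  have unique U (A : set U) a b : card_eq A (fun k => (k < a)%N) ->
      card_eq A (fun k => (k < b)%N) -> a = b.
    by move=> Aa Ab; apply/card_eq_II; apply: card_eq_trans Ab; rewrite card_eq_sym.
  by rewrite (unique _ _ _ _ c1 fin) (unique _ _ _ _ c2 inf) addn1.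
by exists #|[pred ab : K * K | on_curve p f ab]|, 1; split=> //; rewrite addn1.
Qed.

End PointCount.

(** * Trace and equidistribution over a finite field *)

Lemma card_sum_bool (T : finType) (P : pred T) : #|P| = (\sum_x (P x : nat))%N.
Proof. by rewrite -sum1_card big_mkcond; apply: eq_bigr => x _; rewrite unfold_in; case: (P x). Qed.

Lemma sum_leq_eq (T : finType) (P : pred T) (a : T -> nat) b :
  (forall t, P t -> a t <= b)%N -> (\sum_(t | P t) a t = #|P| * b)%N ->
  forall t, P t -> a t = b.
Proof.
move=> ab s t Pt; apply/eqP; rewrite eqn_leq ab //= leqNgt; apply/negP => lt_ab.
have := s; rewrite -sum_nat_const; apply/eqP; rewrite ltn_eqF //.
rewrite (bigD1 t) //= [ltnRHS](bigD1 t) //= -addSn leq_add //.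
by apply: leq_sum => i /andP[Pi _]; apply: ab.
Qed.

Lemma sum_pred1 (T : finType) (P : pred T) (a : T) :
  (\sum_(e | P e) (a == e : nat) = P a)%N.
Proof.
case Pa: (P a); last first.
  by rewrite big1 // => e Pe; case: eqP => // ae; rewrite ae Pe in Pa.
by rewrite (bigD1 a) //= eqxx big1 ?addn0 // => e /andP[_ ea]; rewrite eq_sym (negPf ea).
Qed.

Lemma pred_expn_double a k : ((a ^ (2 * k)).-1 = (a ^ k).+1 * (a ^ k).-1)%N.
Proof. by rewrite mul2n -addnn expnD; case: (a ^ k)%N => // b; rewrite /= mulSn mulnS; lia. Qed.

Section FiniteField.
Variables (F : finFieldType) (p m : nat).
Hypothesis p_pr : prime p.
Hypothesis cardF : #|F| = (p ^ m)%N.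
Hypothesis m_gt0 : (0 < m)%N.

Let p_gt1 : (1 < p)%N := prime_gt1 p_pr.
Let p_gt0 : (0 < p)%N := prime_gt0 p_pr.
Let charF : p \in [pchar F]. Proof. exact: card_finPcharP cardF p_pr. Qed.

Lemma frobD k (x y : F) : (x + y) ^+ (p ^ k) = x ^+ (p ^ k) + y ^+ (p ^ k).
Proof. exact: exprD_pchar. Qed.

Lemma frobN k (x : F) : (- x) ^+ (p ^ k) = - x ^+ (p ^ k).
Proof.
apply/eqP; rewrite -addr_eq0 -frobD addNr expr0n expn_eq0.
by rewrite eqn0Ngt p_gt0.
Qed.

Lemma frob_inj k : injective (fun x : F => x ^+ (p ^ k)).
Proof.
move=> x y /= /eqP; rewrite -subr_eq0 -frobN -frobD expf_eq0 subr_eq0.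
by case/andP => _ /eqP.
Qed.

Lemma frob_card (x : F) : x ^+ (p ^ m) = x.
Proof. by rewrite -cardF expf_card. Qed.

Definition trace (x : F) := \sum_(i < m) x ^+ (p ^ i).

Lemma traceD x y : trace (x + y) = trace x + trace y.
Proof. by rewrite -big_split; apply: eq_bigr => i _; apply: frobD. Qed.

Lemma trace0 : trace 0 = 0.
Proof. by apply: (addrI (trace 0)); rewrite -traceD !addr0. Qed.

Lemma traceN x : trace (- x) = - trace x.
Proof. by apply: (addrI (trace x)); rewrite -traceD !subrr trace0. Qed.

Lemma trace_frob1 x : trace (x ^+ p) = trace x.
Proof.
rewrite /trace; case: m m_gt0 frob_card => // k _ fm.
rewrite big_ord_recr big_ord_recl /= -exprM -expnS fm expn0 expr1 addrC.
by congr (_ + _); apply: eq_bigr => i _; rewrite -exprM -expnS.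
Qed.

Lemma trace_frob k x : trace (x ^+ (p ^ k)) = trace x.
Proof. by elim: k => [|k IH]; rewrite ?expr1 // expnSr exprM trace_frob1. Qed.

Definition prime_field := [pred c : F | c ^+ p == c].

Lemma trace_prime_field x : trace x \in prime_field.
Proof.
rewrite inE -{2}(trace_frob1 x) /trace -[X in _ ^+ X]expn1 (expr_sum_pchar charF) expn1.
by apply/eqP/eq_bigr => i _; rewrite -!exprM mulnC.
Qed.

Lemma prime_field_frob k c : c \in prime_field -> c ^+ (p ^ k) = c.
Proof. by rewrite inE => /eqP cp; elim: k => [|k IH]; rewrite ?expr1 // expnSr exprM IH. Qed.

Lemma traceZ c x : c \in prime_field -> trace (c * x) = c * trace x.
Proof.
move=> cp; rewrite mulr_sumr; apply: eq_bigr => i _.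
by rewrite exprMn (prime_field_frob _ cp).
Qed.

Lemma prime_fieldD c d : c \in prime_field -> d \in prime_field -> c + d \in prime_field.
Proof.
rewrite !inE => /eqP cp /eqP dp; have := frobD 1 c d.
by rewrite !expn1 cp dp => ->; rewrite eqxx.
Qed.
Lemma prime_fieldN c : c \in prime_field -> - c \in prime_field.
Proof. by rewrite !inE => /eqP cp; have := frobN 1 c; rewrite !expn1 cp => ->; rewrite eqxx. Qed.
Lemma prime_fieldM c d : c \in prime_field -> d \in prime_field -> c * d \in prime_field.
Proof. by rewrite !inE exprMn => /eqP -> /eqP ->; rewrite eqxx. Qed.
Lemma prime_fieldV c : c \in prime_field -> c^-1 \in prime_field.
Proof. by rewrite !inE exprVn => /eqP ->; rewrite eqxx. Qed.
Lemma prime_field0 : 0 \in prime_field.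
Proof. by rewrite inE expr0n eqn0Ngt p_gt0 eqxx. Qed.
Lemma prime_field1 : 1 \in prime_field.
Proof. by rewrite inE expr1n eqxx. Qed.

(** The trace is a polynomial function of degree p^(m-1), less than the number of
    elements of the field. *)
Lemma trace_neq0 : exists w, trace w != 0.
Proof.
apply/existsP; apply: contraT => /existsPn tr0.
pose P : {poly F} := \sum_(i < m) 'X^(p ^ i).
have sP : size P = (p ^ m.-1).+1.
  rewrite /P; case: m m_gt0 => // k _; rewrite big_ord_recr /= addrC size_polyDl size_polyXn //.
  rewrite ltnS; apply: leq_trans (size_sum _ _ _) _; apply/bigmax_leqP => i _.
  by rewrite size_polyXn ltn_exp2l.
have := @max_poly_roots _ P (enum F); rewrite -cardE cardF sP enum_uniq ltnS.
rewrite leq_exp2l // -ltnS prednK // ltnn => -> //; first by rewrite -size_poly_gt0 sP.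
apply/allP => x _; rewrite rootE /P horner_sum.
have := tr0 x; rewrite negbK => /eqP tx; apply/eqP; rewrite -[RHS]tx.
by apply: eq_bigr => i _; rewrite hornerXn.
Qed.

Variable alpha : F.
Hypothesis alpha_prim : ((p ^ m).-1).-primitive_root alpha.

Lemma card_unity_roots d : (d %| (p ^ m).-1)%N ->
  (\sum_(x : F) (x ^+ d == 1%R : nat))%N = d.
Proof.
move=> dvd; have prim_d := dvdn_prim_root alpha_prim dvd.
set z := alpha ^+ _ in prim_d.
rewrite -(card_sum_bool (fun x => x ^+ d == 1)).
rewrite -[RHS]card_ord -(card_imset (f := fun i : 'I_d => z ^+ i)).
  apply: eq_card => x; apply/idP/imsetP => [xd|[i _ ->]].
    have xd1 : x ^+ d = 1 by exact/eqP.
    by have [i ->] := prim_rootP prim_d xd1; exists i.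
  suff : z ^+ i ^+ d == 1 by [].
  by rewrite -exprM mulnC exprM (prim_expr_order prim_d) expr1n eqxx.
move=> i j /eqP; rewrite (eq_prim_root_expr prim_d) !modn_small //.
by move/eqP/val_inj.
Qed.

Lemma card_expf_fixed d : (1 < d)%N -> (d.-1 %| (p ^ m).-1)%N ->
  (\sum_(x : F) (x ^+ d == x : nat))%N = d.
Proof.
move=> d_gt1 dvd; have d_gt0 := ltnW d_gt1.
rewrite (bigD1 0) //= expr0n (gtn_eqF d_gt0) eqxx.
rewrite -[RHS](prednK d_gt0) -add1n; congr (_ + _)%N.
rewrite -[RHS](card_unity_roots dvd) [RHS](bigD1 0) //= expr0n.
have -> : (d.-1 == 0)%N = false by lia.
rewrite eq_sym oner_eq0 add0n.
apply: eq_bigr => x x0; congr (nat_of_bool _).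
by rewrite -[in LHS](prednK d_gt0) exprS -[X in _ == X]mulr1 (inj_eq (mulfI x0)).
Qed.

Lemma card_prime_field : #|prime_field| = p.
Proof. by rewrite card_sum_bool -[RHS]card_expf_fixed // dvdn_pred_predX. Qed.

(** Translations by the multiples c w permute A and shift g by c t, so they permute
    the level sets of g transitively. *)
Lemma equidistribution (A : pred F) (g : F -> F) (w t : F) :
  (forall x, A x -> g x \in prime_field) -> t \in prime_field -> t != 0 ->
  (forall c x, c \in prime_field -> A (x + c * w) = A x) ->
  (forall c x, c \in prime_field -> A x -> g (x + c * w) = g x + c * t) ->
  forall e, e \in prime_field ->
  (p * \sum_x (A x && (g x == e) : nat) = \sum_x (A x : nat))%N.
Proof.
move=> gP tP t0 Aw gw e eP.
have cnt0 e' : e' \in prime_field ->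
    (\sum_x (A x && (g x == e') : nat) = \sum_x (A x && (g x == 0%R) : nat))%N.
  move=> e'P; rewrite (reindex_inj (addIr (e' / t * w))) /=.
  have cP : e' / t \in prime_field by apply: prime_fieldM => //; apply: prime_fieldV.
  apply: eq_bigr => x _; rewrite Aw //; case Ax : (A x) => //=.
  by rewrite gw // divfK // -[X in _ == X]add0r (inj_eq (addIr _)).
rewrite cnt0 // -[in LHS]card_prime_field -sum_nat_const.
under eq_bigr => e' e'P do rewrite -(cnt0 e') //.
rewrite exchange_big /=; apply: eq_bigr => x _.
case Ax : (A x) => /=; last by rewrite big1.
by rewrite sum_pred1 gP.
Qed.

Lemma card_trace_fibre (a e : F) : a != 0 -> e \in prime_field ->
  (p * \sum_(x : F) (trace (a * x)%R == e : nat) = p ^ m)%N.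
Proof.
move=> a0 eP; have [w w0] := trace_neq0.
rewrite (@equidistribution predT (fun x => trace (a * x)) (w / a) (trace w)) //.
- by rewrite sum_nat_const muln1 cardF.
- by move=> x _; apply: trace_prime_field.
- exact: trace_prime_field.
move=> c x cP _; rewrite mulrDr traceD -(traceZ _ cP).
by congr (_ + trace _); rewrite mulrCA [a * _]mulrC divfK.
Qed.

(** The elements of trace 0 number p^(m-1), each has at most p preimages under
    b^p - b, and all p^m elements b map to them; so each has exactly p. *)
Lemma card_artin_schreier_fibre c :
  (\sum_(b : F) ((b ^+ p - b)%R == c : nat) = (trace c == 0%R) * p)%N.
Proof.
have le_p c' : (\sum_(b : F) ((b ^+ p - b)%R == c' : nat) <= p)%N.
  rewrite -(card_sum_bool (fun b => b ^+ p - b == c')).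
  pose P : {poly F} := 'X^p - 'X - c'%:P.
  have sP : size P = p.+1 by exact: (size_artin_schreier charF c').
  have := @max_poly_roots _ P (enum (fun b : F => b ^+ p - b == c')).
  rewrite -cardE sP enum_uniq ltnS; apply=> //; first by rewrite -size_poly_gt0 sP.
  by apply/allP => b; rewrite mem_enum => bP; rewrite rootE !hornerE subr_eq0.
have tr0 b : trace (b ^+ p - b) = 0.
  by rewrite traceD traceN trace_frob1 subrr.
case: eqP => [trc|trc]; last first.
  by rewrite mul0n big1 // => b _; case: eqP => // eb; case: trc; rewrite -eb.
pose sols (c : F) := (\sum_(b : F) (b ^+ p - b == c)%R)%N.
suff all_p : forall c', trace c' == 0 -> sols c' = p.
  by rewrite mul1n -[RHS](all_p c) ?trc ?eqxx.
apply: sum_leq_eq => [c' _|]; first exact: le_p.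
rewrite /sols exchange_big /=; under eq_bigr => b _ do rewrite sum_pred1 tr0 eqxx.
rewrite sum_nat_const muln1 cardF card_sum_bool mulnC.
rewrite -(card_trace_fibre (oner_neq0 F) prime_field0); congr (_ * _)%N.
by apply: eq_bigr => x _; rewrite mul1r.
Qed.

Lemma card_on_curve (f : {poly F}) :
  (#|[pred ab : F * F | on_curve p f ab]| = p * \sum_a (trace f.[a] == 0%R : nat))%N.
Proof.
rewrite card_sum_bool -(pair_big predT predT (fun a b => (on_curve p f (a, b) : nat))) /=.
rewrite big_distrr /=; apply: eq_bigr => a _.
by rewrite mulnC -card_artin_schreier_fibre.
Qed.

Lemma Posz_exp a k : (a ^ k)%N%:Z = a%:Z ^+ k.
Proof. by elim: k => // k IH; rewrite expnS exprS PoszM IH. Qed.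

(** * The quadratic form Tr (gamma x^(q+1)) *)

Section QuadraticForm.
Variables (l s : nat) (gamma w0 : F).
Hypothesis l_gt0 : (0 < l)%N.
Hypothesis m_def : m = (l * (2 * s))%N.
Hypothesis w0_neq0 : w0 != 0.
Hypothesis gamma_neq0 : gamma != 0.
Local Notation q := (p ^ l)%N.
Hypothesis w0_radical : gamma ^+ q * w0 ^+ (p ^ (2 * l)) = - (gamma * w0).

Let s_gt0 : (0 < s)%N. Proof. by case: s m_def m_gt0 => // ->; rewrite !muln0. Qed.
Let q_gt1 : (1 < q)%N. Proof. by rewrite (leq_trans p_gt1) // -{1}(expn1 p) leq_exp2l. Qed.

Definition quad x := trace (gamma * x ^+ q.+1).
Definition polar x z := trace (gamma * (x ^+ q * z + x * z ^+ q)).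
(** An additive polynomial that represents the polar form: polar x z is the trace of
    radical_map z times x^q, so its kernel is the radical. *)
Definition radical_map z := gamma ^+ q * z ^+ (p ^ (2 * l)) + gamma * z.
Definition radical := [pred z | radical_map z == 0].

Lemma expr_q2 (x : F) : x ^+ (p ^ (2 * l)) = x ^+ q ^+ q.
Proof. by rewrite -exprM -expnD addnn mul2n. Qed.

Lemma quad_prime_field x : quad x \in prime_field.
Proof. exact: trace_prime_field. Qed.

Lemma quadD x z : quad (x + z) = quad x + quad z + polar x z.
Proof.
rewrite /quad /polar -!traceD; congr trace.
by rewrite !(exprSr _ q) frobD; ring.
Qed.

Lemma polarC x z : polar x z = polar z x.
Proof. by rewrite /polar addrC [z * _]mulrC [z ^+ _ * _]mulrC. Qed.

Lemma polarE x z : polar x z = trace (radical_map z * x ^+ q).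
Proof.
rewrite /polar /radical_map mulrDr traceD mulrDl traceD addrC.
congr (_ + _); last by congr trace; ring.
by rewrite -(trace_frob l) !exprMn expr_q2; congr trace; ring.
Qed.

Lemma polar_radical x z : z \in radical -> polar x z = 0.
Proof. by rewrite inE polarE => /eqP ->; rewrite mul0r trace0. Qed.

Lemma radical_mapD z w : radical_map (z + w) = radical_map z + radical_map w.
Proof. by rewrite /radical_map frobD !mulrDr addrACA. Qed.

(** The hypothesis on w0 makes w0 times the field with p^(2l) elements the radical. *)
Lemma radicalE c : (w0 * c \in radical) = (c ^+ (p ^ (2 * l)) == c).
Proof.
rewrite inE /radical_map exprMn (mulrA (gamma ^+ q)) w0_radical mulNr addrC mulrA.
rewrite -mulrBr mulf_eq0.
by rewrite mulf_eq0 (negPf gamma_neq0) (negPf w0_neq0) /= subr_eq0 eq_sym.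
Qed.

Lemma radicalZ c z : c \in prime_field -> z \in radical -> c * z \in radical.
Proof.
move=> cP; rewrite !inE /radical_map exprMn (prime_field_frob _ cP) => /eqP z0.
by rewrite [gamma * (c * z)]mulrCA [gamma ^+ q * _]mulrCA -mulrDr z0 mulr0.
Qed.

Lemma radicalD z w : z \in radical -> w \in radical -> z + w \in radical.
Proof. by rewrite !inE radical_mapD => /eqP -> /eqP ->; rewrite addr0. Qed.

Lemma dvdn_q2 : ((p ^ (2 * l)).-1 %| (p ^ m).-1)%N.
Proof. by rewrite m_def mulnCA mulnA (expnM p (2 * l) s) dvdn_pred_predX. Qed.

Lemma card_radical : #|radical| = (p ^ (2 * l))%N.
Proof.
have q2_gt1 : (1 < p ^ (2 * l))%N by rewrite (leq_trans p_gt1) // -{1}(expn1 p) leq_exp2l // muln_gt0.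
rewrite card_sum_bool (reindex_inj (mulfI w0_neq0)) /= -[RHS](card_expf_fixed q2_gt1 dvdn_q2).
by apply: eq_bigr => c _; rewrite -[radical_map _ == 0]/(w0 * c \in radical) radicalE.
Qed.

(** The summands of the trace change sign under a shift of the index by l, and m is an
    even multiple of l. *)
Lemma trace_antiperiodic (a : F) : a ^+ q = - a -> trace a = 0.
Proof.
move=> aq; pose T n := \sum_(i < n) a ^+ (p ^ i).
have TD n : T (l + n)%N = T l - T n.
  rewrite /T big_split_ord /=; congr (_ + _); rewrite -sumrN; apply: eq_bigr => i _.
  by rewrite expnD exprM aq frobN.
suff T0 k : T (l * (2 * k))%N = 0 by rewrite /trace m_def; apply: T0.
elim: k => [|k IH]; first by rewrite !muln0 /T big_ord0.
by rewrite mulnS mulnDr muln2 -addnn -addnA !TD IH subr0 subrr.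
Qed.

Lemma quad_radical z : z \in radical -> quad z = 0.
Proof.
rewrite inE /radical_map addr_eq0 => /eqP rz; apply: trace_antiperiodic.
have -> : (gamma * z ^+ q.+1) ^+ q = gamma ^+ q * z ^+ (p ^ (2 * l)) * z ^+ q.
  by rewrite exprMn (exprSr z) exprMn -expr_q2 mulrA.
by rewrite rz (exprSr z); ring.
Qed.

Definition level c := (\sum_x (quad x == c : nat))%N.

(** A nonzero c in the prime field is alpha^i with i divisible by (p^m - 1) / (p - 1),
    and q + 1 divides this number because p - 1 divides q - 1. *)
Lemma norm_surjective c : c \in prime_field -> c != 0 ->
  exists2 k : F, k != 0 & k ^+ q.+1 = c.
Proof.
move=> cP c0.
have c1 : c ^+ (p ^ m).-1 = 1.
  by apply: (mulfI c0); rewrite -exprS prednK ?expn_gt0 ?p_gt0 // frob_card mulr1.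
have [i ci] := prim_rootP alpha_prim c1.
have dvd : (q.+1 %| i)%N.
  have p1 : (0 < p.-1)%N by rewrite -ltnS prednK.
  have dvd1 : ((p ^ m).-1 %| i * p.-1)%N.
    rewrite (prim_order_dvd alpha_prim) exprM -ci; apply/eqP/(mulfI c0).
    by rewrite -exprS prednK // mulr1; apply/eqP; rewrite inE in cP.
  rewrite -(@dvdn_pmul2r p.-1) //; apply: dvdn_trans dvd1; apply: dvdn_trans dvdn_q2.
  by rewrite pred_expn_double dvdn_pmul2l // dvdn_pred_predX.
have [j ij] := dvdnP dvd.
exists (alpha ^+ j); last by rewrite -exprM -ij.
by apply: contra_neq c0 => aj; rewrite ci ij exprM aj expr0n.
Qed.

Lemma level_neq0 c : c \in prime_field -> c != 0 -> level c = level 1.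
Proof.
move=> cP c0; have [k k0 kc] := norm_surjective cP c0.
rewrite /level (reindex_inj (mulfI k0)); apply: eq_bigr => x _; congr nat_of_bool.
rewrite /quad exprMn kc mulrCA (traceZ _ cP) -[X in _ == X]mulr1.
by rewrite (inj_eq (mulfI c0)).
Qed.

Lemma level_sum : (level 0%R + p.-1 * level 1%R = p ^ m)%N.
Proof.
have -> : (p ^ m = \sum_(c in prime_field) level c)%N.
  rewrite exchange_big /=; under eq_bigr => x _ do rewrite sum_pred1 quad_prime_field.
  by rewrite sum_nat_const muln1 cardF.
rewrite (bigD1 0) ?prime_field0 //=; congr (_ + _)%N.
rewrite (eq_bigr (fun=> level 1)) => [|c /andP[cP c0]]; last exact: level_neq0.
rewrite sum_nat_const; congr (_ * _)%N.
have := cardD1 (0 : F) prime_field; rewrite card_prime_field prime_field0 add1n => ->.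
by apply: eq_card => c; rewrite !inE andbC.
Qed.

(** The number of pairs (x, z) with Q(x + z) - Q(x) = c, counted by z: for z in the
    radical the condition is c = 0, otherwise it is a nonzero affine linear condition
    on x. *)
Lemma second_moment (c : F) : c \in prime_field ->
  (\sum_x level (quad x + c)%R =
   (c == 0)%R * (p ^ (2 * l) * p ^ m) + (p ^ m - p ^ (2 * l)) * (p ^ m %/ p))%N.
Proof.
move=> cP.
have -> : (\sum_x level (quad x + c)%R = \sum_z \sum_x (quad z + polar x z == c)%R)%N.
  rewrite [RHS]exchange_big; apply: eq_bigr => x _; rewrite /level (reindex_inj (addrI x)).
  apply: eq_bigr => z _; congr nat_of_bool.
  by rewrite quadD -addrA (inj_eq (addrI _)).
rewrite (bigID (mem radical)) /=; congr (_ + _)%N.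
  rewrite (eq_bigr (fun=> (c == 0)%R * p ^ m)%N) => [|z zR].
    by rewrite sum_nat_const card_radical mulnCA.
  under eq_bigr => x _ do rewrite quad_radical // polar_radical // addr0 eq_sym.
  by rewrite sum_nat_const cardF mulnC.
rewrite (eq_bigr (fun=> p ^ m %/ p)%N) => [|z zR].
  rewrite sum_nat_const; congr (_ * _)%N; have := cardC (mem radical).
  by rewrite cardF -card_radical => <-; rewrite addKn.
have z0 : radical_map z != 0 by move: zR; rewrite inE.
have cz : c - quad z \in prime_field by apply: prime_fieldD => //; apply/prime_fieldN/quad_prime_field.
rewrite -(card_trace_fibre z0 cz) mulKn // [RHS](reindex_inj (frob_inj (k := l))).
apply: eq_bigr => x _; congr nat_of_bool.
by rewrite polarE addrC eq_sym -subr_eq eq_sym.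
Qed.

Definition level_gap : int := (level 0)%:Z - (level 1)%:Z.

Lemma level_int c : c \in prime_field ->
  (level c)%:Z = (level 1)%:Z + level_gap * (c == 0)%:Z.
Proof.
move=> cP; case: (eqVneq c 0) => [->|c0]; first by rewrite mulr1 /level_gap addrC subrK.
by rewrite level_neq0 // mulr0 addr0.
Qed.

(** The second moments at 0 and at 1 differ by p^(2l) p^m, and, N(c) being constant
    for c <> 0, also by the square of the gap. *)
Lemma level_gap_sqr : level_gap ^+ 2 = (q ^ s.+1)%:Z ^+ 2.
Proof.
have sumZ (G : F -> nat) : (\sum_x G x)%N%:Z = \sum_x (G x)%:Z.
  by apply: (big_morph Posz PoszD).
have e0 := second_moment prime_field0; have e1 := second_moment prime_field1.
rewrite eqxx mul1n in e0; rewrite oner_eq0 mul0n add0n in e1; rewrite -e1 in e0.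
have : ((\sum_x level (quad x + 0)%R)%N%:Z - (\sum_x level (quad x + 1)%R)%N%:Z =
    (p ^ (2 * l) * p ^ m)%N%:Z)%R by rewrite e0; lia.
rewrite !sumZ -sumrB.
rewrite (eq_bigr (fun x => level_gap * ((quad x == 0)%:Z - (quad x == -1)%:Z))).
  rewrite -mulr_sumr sumrB -!sumZ -[X in X%:Z - _]/(level 0) -[X in _ - X%:Z]/(level (-1)).
  rewrite (level_neq0 (prime_fieldN prime_field1)) ?oppr_eq0 ?oner_eq0 //.
  rewrite -/level_gap -expr2 => ->; rewrite -Posz_exp; congr Posz.
  by rewrite m_def -expnD -!expnM; congr (_ ^ _)%N; lia.
move=> x _; have Qx := quad_prime_field x.
rewrite (level_int (prime_fieldD Qx prime_field0)) (level_int (prime_fieldD Qx prime_field1)).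
by rewrite addr0 addr_eq0; ring.
Qed.

(** Q(x) depends on x only through x^(q+1), whose nonempty fibres off 0 have q + 1
    elements. *)
Lemma dvdn_level1 : (q.+1 %| level 1%R)%N.
Proof.
have -> : (level 1%R = \sum_y \sum_x ((x ^+ q.+1 == y) && (trace (gamma * y) == 1))%R)%N.
  rewrite [RHS]exchange_big; apply: eq_bigr => x _.
  rewrite (bigD1 (x ^+ q.+1)) //= eqxx big1 ?addn0 // => y yx.
  by rewrite eq_sym (negPf yx).
apply: dvdn_sum => y _; case: eqP => [ty|_]; last first.
  by rewrite big1 // => x _; rewrite andbF.
have y0 : y != 0 by apply: contra_eq_neq ty => ->; rewrite mulr0 trace0 eq_sym oner_neq0.
under eq_bigr => x _ do rewrite andbT.
have [/existsP [x0 /eqP x0y]|/existsPn nx] := boolP [exists x, x ^+ q.+1 == y]; last first.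
  by rewrite big1 // => x _; rewrite (negPf (nx x)).
have dvd : (q.+1 %| (p ^ m).-1)%N.
  by apply: dvdn_trans dvdn_q2; rewrite pred_expn_double dvdn_mulr.
have x00 : x0 != 0 by apply: contra_neq y0 => x00; rewrite -x0y x00 expr0n.
suff -> : (\sum_x ((x ^+ q.+1 == y)%R) = \sum_(x : F) (x ^+ q.+1 == 1)%R)%N.
  by rewrite card_unity_roots.
rewrite (reindex_inj (mulfI x00)); apply: eq_bigr => x _; congr nat_of_bool.
by rewrite exprMn x0y -[X in _ == X]mulr1 (inj_eq (mulfI y0)).
Qed.

(** The gap is p^m - p N(1), so it is congruent to 1 modulo q + 1, and so is
    (-q)^(s+1).  The opposite sign would make q + 1 divide 2. *)
Lemma level_gapE : level_gap = (- q%:Z) ^+ s.+1.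
Proof.
have q1 k : (q.+1%:Z %| (- q%:Z) ^+ k - 1)%Z.
  have -> : (- q%:Z) ^+ k - 1 = q.+1%:Z * (- \sum_(i < k) (- q%:Z) ^+ i).
    by rewrite subrX1 mulrN -mulNr; congr (_ * _); lia.
  by rewrite dvdz_mulr.
have pmE : (p ^ m)%N%:Z = (- q%:Z) ^+ (2 * s).
  by rewrite exprM sqrrN -exprM -Posz_exp m_def expnM.
have gap1 : (q.+1%:Z %| level_gap - 1)%Z.
  have -> : level_gap - 1 = ((- q%:Z) ^+ (2 * s) - 1) - p%:Z * (level 1)%:Z.
    rewrite -pmE -level_sum /level_gap PoszD PoszM predn_int //; ring.
  apply: rpredB; first exact: q1.
  by apply: dvdz_mull; exact: dvdn_level1.
have /eqP := level_gap_sqr.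
have -> : (q ^ s.+1)%:Z ^+ 2 = ((- q%:Z) ^+ s.+1) ^+ 2.
  by rewrite -[RHS]exprM mulnC exprM sqrrN -exprM mulnC exprM Posz_exp.
rewrite eqf_sqr => /orP[/eqP //|/eqP gapN].
have : (q.+1%:Z %| 2%:Z)%Z.
  have -> : 2%:Z = - (level_gap - 1) - ((- q%:Z) ^+ s.+1 - 1) by rewrite gapN; ring.
  by apply: rpredB; [rewrite rpredN | exact: q1].
by rewrite dvdzE /= => /dvdn_leq; lia.
Qed.

Definition num_zeros beta := (\sum_(x : F) ((quad x + trace (beta * x))%R == 0%R : nat))%N.

Definition radical_orth := [pred beta | [forall w in radical, trace (beta * w) == 0]].

(** Translation by a multiple of an element w of the radical changes the linear term
    but not the quadratic one. *)
Lemma num_zeros_not_orth beta : beta \notin radical_orth -> (p * num_zeros beta = p ^ m)%N.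
Proof.
rewrite inE => /forall_inPn [w wR t0].
rewrite /num_zeros (@equidistribution predT (fun x => quad x + trace (beta * x)) w (trace (beta * w))) //.
- by rewrite sum_nat_const muln1 cardF.
- by move=> x _; apply: prime_fieldD; [exact: quad_prime_field | exact: trace_prime_field].
- exact: trace_prime_field.
- move=> c x cP _; have cwR := radicalZ cP wR.
  rewrite quadD (quad_radical cwR) (polar_radical x cwR) !addr0 mulrDr traceD.
  by rewrite mulrCA (traceZ _ cP) addrA.
exact: prime_field0.
Qed.

(** The pairs (beta, w) with Tr (beta w) = 0 and w in the radical are counted in two
    ways. *)
Lemma card_radical_orth : (#|radical_orth| * p ^ (2 * l) = p ^ m)%N.
Proof.
(* Summing over beta first: a nonzero w is orthogonal to a fraction 1/p of all beta. *)
have cnt_w (w : F) : w \in radical ->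
    (p * \sum_(beta : F) (trace (beta * w)%R == 0%R) = p ^ m * (if w == 0%R then p else 1))%N.
  move=> wR; have [->|wn0] := eqVneq w 0.
    rewrite mulnC; congr (_ * _)%N; under eq_bigr => b _ do rewrite mulr0 trace0 eqxx.
    by rewrite sum_nat_const muln1 cardF.
  rewrite muln1 -(card_trace_fibre wn0 prime_field0); congr (_ * _)%N.
  by apply: eq_bigr => b _; rewrite mulrC.
(* Summing over w first: a beta outside radical_orth is orthogonal to a fraction 1/p of the radical. *)
have cnt_b beta : (p * \sum_(w in radical) (trace (beta * w)%R == 0%R) =
    p ^ (2 * l) * (if beta \in radical_orth then p else 1))%N.
  case: ifPn => [bR|]; last rewrite inE => /forall_inPn [w wR t0].
    rewrite mulnC; congr (_ * _)%N; rewrite -card_radical -sum1_card.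
    by apply: eq_bigr => w wR; move: bR; rewrite inE => /forall_inP -> .
  rewrite muln1 -card_radical card_sum_bool.
  rewrite -(@equidistribution (mem radical) (fun x => trace (beta * x)) w (trace (beta * w)) _ _ t0 _ _ 0).
  - congr (_ * _)%N; rewrite big_mkcond; apply: eq_bigr => x _.
    by rewrite /=; case: (x \in radical).
  - by move=> x _; apply: trace_prime_field.
  - exact: trace_prime_field.
  - move=> c x cP /=; have cwR := radicalZ cP wR.
    apply/idP/idP => [xcR|xR]; last exact: radicalD.
    have := radicalD xcR (radicalZ (prime_fieldN cP) wR).
    by rewrite mulNr addrK.
  - by move=> c x cP _; rewrite mulrDr traceD mulrCA (traceZ _ cP).
  exact: prime_field0.
have : (\sum_(w in radical) p ^ m * (if w == 0%R then p else 1) =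
        \sum_beta p ^ (2 * l) * (if beta \in radical_orth then p else 1))%N.
  rewrite -(eq_bigr _ cnt_w) -(eq_bigr _ (fun b _ => cnt_b b)) -!big_distrr /=.
  by rewrite exchange_big.
(* Comparing the two sums, the terms without the factor p - 1 agree and cancel. *)
have if_p (T : finType) (P : pred T) (A : pred T) :
    (\sum_(t | A t) (if P t then p else 1) = #|A| + p.-1 * \sum_(t | A t) P t)%N.
  rewrite big_distrr -sum1_card -big_split /=; apply: eq_bigr => t _.
  by case: (P t); rewrite ?muln1 ?muln0 // add1n prednK.
rewrite -!big_distrr !if_p /= card_radical cardF -card_sum_bool.
have -> : (\sum_(t in radical) (t == 0)%R = 1)%N.
  under eq_bigr => t _ do rewrite eq_sym.
  by rewrite sum_pred1 inE /radical_map expr0n expn_eq0 (gtn_eqF p_gt0) !mulr0 addr0 eqxx.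
rewrite muln1 !mulnDr [(p ^ m * _)%N]mulnC => /addnI.
rewrite mulnCA mulnC => /eqP; rewrite eqn_pmul2l ?[(#|_| * _)%N]mulnC; first by move/eqP.
by rewrite -ltnS prednK.
Qed.

(** Raising to the power p^(m-l) inverts the p^l-th power, so that polarE takes the
    form trace_polar_dual. *)
Definition polar_dual z := radical_map z ^+ (p ^ (m - l)).

Lemma l_le_m : (l <= m)%N.
Proof. by rewrite m_def leq_pmulr // muln_gt0. Qed.

Lemma trace_polar_dual z x : trace (polar_dual z * x) = polar x z.
Proof.
rewrite polarE -(trace_frob l) exprMn /polar_dual -exprM -expnD subnK ?l_le_m //.
by rewrite frob_card.
Qed.

Lemma polar_dual_eq z w : (polar_dual z == polar_dual w) = (z - w \in radical).
Proof.
rewrite /polar_dual (inj_eq (frob_inj (k := m - l))) inE radical_mapD.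
have -> : radical_map (- w) = - radical_map w.
  by rewrite /radical_map frobN !mulrN opprD.
by rewrite subr_eq0.
Qed.

(** Completing the square: Q(x) + polar x z = Q(x + z) - Q(z). *)
Lemma num_zeros_polar_dual z : num_zeros (polar_dual z) = level (quad z).
Proof.
rewrite /level (reindex_inj (addIr z)); apply: eq_bigr => x _; congr nat_of_bool.
by rewrite trace_polar_dual quadD [quad x + quad z + _]addrAC -[RHS]subr_eq0 addrK.
Qed.

Lemma card_polar_dual_fibre z : (\sum_w (polar_dual w == polar_dual z) = p ^ (2 * l))%N.
Proof.
rewrite -card_radical card_sum_bool (reindex_inj (addIr z)).
by apply: eq_bigr => w _; rewrite polar_dual_eq addrK.
Qed.

Lemma sum_polar_dual (P : pred F) :
  (\sum_(z : F) P (polar_dual z) = #|[pred b in codom polar_dual | P b]| * p ^ (2 * l))%N.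
Proof.
have -> : (\sum_(z : F) P (polar_dual z) = \sum_b \sum_z (P b && (polar_dual z == b)))%N.
  rewrite exchange_big; apply: eq_bigr => z _.
  rewrite (bigD1 (polar_dual z)) //= eqxx andbT big1 ?addn0 // => b bz.
  by rewrite [polar_dual z == b]eq_sym (negPf bz) andbF.
rewrite card_sum_bool big_distrl; apply: eq_bigr => b _ /=.
rewrite /=; case Pb : (P b); last by rewrite andbF mul0n big1.
rewrite andbT /=.
have [/codomP [z ->]|nb] := boolP (b \in codom polar_dual); first by rewrite card_polar_dual_fibre mul1n.
rewrite mul0n big1 // => z _; apply/eqP; rewrite eqb0.
by apply: contraNneq nb => <-; apply: codom_f.
Qed.

(** The range is contained in the orthogonal of the radical, and both have p^m / p^(2l)
    elements. *)
Lemma codom_polar_dual : codom polar_dual =i radical_orth.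
Proof.
have q2_gt0 : (0 < p ^ (2 * l))%N by rewrite expn_gt0 p_gt0.
apply/subset_cardP.
  apply/eqP; rewrite -(eqn_pmul2r q2_gt0) card_radical_orth -cardF.
  have := sum_polar_dual predT; rewrite (eq_bigr (fun=> 1%N)) // sum_nat_const muln1 => ->.
  by rewrite eqn_pmul2r //; apply/eqP/eq_card => b; rewrite [RHS]inE andbT.
apply/fintype.subsetP => _ /codomP [z ->]; rewrite inE; apply/forall_inP => w wR.
by rewrite trace_polar_dual polarC polar_radical.
Qed.

Lemma level0E : (p * level 0%R)%N%:Z = (p ^ m)%N%:Z + p.-1%:Z * (- q%:Z) ^+ s.+1.
Proof.
rewrite -level_gapE -level_sum /level_gap.
have -> : p = p.-1.+1 by rewrite prednK.
rewrite /=; move: p.-1 => k; rewrite PoszM PoszD PoszM; ring.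
Qed.

Lemma level1E : (p * level 1%R)%N%:Z = (p ^ m)%N%:Z - (- q%:Z) ^+ s.+1.
Proof.
rewrite -level_gapE -level_sum /level_gap.
have -> : p = p.-1.+1 by rewrite prednK.
rewrite /=; move: p.-1 => k; rewrite PoszM PoszD PoszM; ring.
Qed.

Lemma gap_neq0 : (- q%:Z) ^+ s.+1 != 0.
Proof. by rewrite expf_neq0 // oppr_eq0; lia. Qed.

(** The elements beta outside the orthogonal of the radical do not contribute, as
    neither level c times p equals p^m. *)
Lemma card_num_zeros (c : F) (P : pred F) : c \in prime_field ->
  (forall z, P z = (level (quad z) == level c)) ->
  (#|[pred beta | num_zeros beta == level c]| * p ^ (2 * l) = \sum_z P z)%N.
Proof.
move=> cP PE.
rewrite (eq_bigr (fun z => (num_zeros (polar_dual z) == level c) : nat)); last first.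
  by move=> z _; rewrite PE num_zeros_polar_dual.
rewrite (sum_polar_dual (fun b => num_zeros b == level c)); congr (_ * _)%N.
apply: eq_card => b; rewrite !inE codom_polar_dual; case: eqP => [zb|]; last by rewrite andbF.
rewrite andbT; apply/esym; apply: contraT => /num_zeros_not_orth; rewrite zb => eb.
have [c0|c0] := eqVneq c 0.
  have := level0E; rewrite -c0 eb => /eqP; rewrite -subr_eq0 opprD addrA subrr sub0r oppr_eq0.
  by rewrite mulf_eq0 (negPf gap_neq0) orbF => /eqP; lia.
exfalso; move: gap_neq0 level1E; rewrite -(level_neq0 cP c0) eb.
by move: ((- q%:Z) ^+ s.+1) => G; lia.
Qed.

Lemma level_neq : level 0%R != level 1%R.
Proof.
apply/eqP => e01; have := level0E; rewrite e01 level1E => /eqP.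
rewrite (inj_eq (addrI _)) -subr_eq0 -mulN1r -mulrBl mulf_eq0 (negPf gap_neq0) orbF.
lia.
Qed.

Lemma card_num_zeros_level0 :
  (#|[pred beta | num_zeros beta == level 0%R]| * p ^ (2 * l) = level 0%R)%N.
Proof.
apply: (card_num_zeros (P := fun z => quad z == 0)) prime_field0 _ => z.
have [->|z0] := eqVneq (quad z) 0; first by rewrite eqxx.
by rewrite (level_neq0 (quad_prime_field z) z0) eq_sym (negPf level_neq).
Qed.

Lemma card_num_zeros_level1 :
  (#|[pred beta | num_zeros beta == level 1%R]| * p ^ (2 * l) = p.-1 * level 1%R)%N.
Proof.
rewrite (card_num_zeros (P := fun z => quad z != 0) prime_field1).
  apply: (@addnI (level 0%R)); rewrite level_sum -cardF -[#|F|]muln1 -sum_nat_const.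
  by rewrite /level -big_split; apply: eq_bigr => z _ /=; case: eqP.
move=> z; have [->|z0] := eqVneq (quad z) 0; first by rewrite (negPf level_neq).
by rewrite (level_neq0 (quad_prime_field z) z0) eqxx.
Qed.

End QuadraticForm.
End FiniteField.

(** * Maximal and minimal curves *)

Section ExtremalCurves.
Variables (F : finFieldType) (p m l s : nat) (alpha gamma w0 : F).
Hypothesis p_pr : prime p.
Hypothesis cardF : #|F| = (p ^ m)%N.
Hypothesis alpha_prim : ((p ^ m).-1).-primitive_root alpha.
Hypothesis l_gt0 : (0 < l)%N.
Hypothesis s_gt0 : (0 < s)%N.
Hypothesis m_def : m = (l * (2 * s))%N.
Hypothesis w0_neq0 : w0 != 0.
Hypothesis gamma_neq0 : gamma != 0.
Local Notation q := (p ^ l)%N.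
Hypothesis w0_radical : (gamma * w0 ^+ q.+1) ^+ q.-1 = -1.

Let p_gt1 : (1 < p)%N := prime_gt1 p_pr.
Let p_gt0 : (0 < p)%N := prime_gt0 p_pr.
Let q_gt0 : (0 < q)%N. Proof. by rewrite expn_gt0 p_gt0. Qed.
Let m_gt0 : (0 < m)%N. Proof. by rewrite m_def !muln_gt0 l_gt0. Qed.
Let charF : p \in [pchar F]. Proof. exact: card_finPcharP cardF p_pr. Qed.

(** The hypothesis on w0, multiplied by gamma w0. *)
Lemma radical_equation : gamma ^+ q * w0 ^+ (p ^ (2 * l)) = - (gamma * w0).
Proof.
have -> : (p ^ (2 * l) = (q.+1 * q.-1).+1)%N.
  by rewrite -pred_expn_double prednK // expn_gt0 p_gt0.
rewrite -{1}(prednK q_gt0) !exprS exprM mulrACA -exprMn w0_radical mulrN1; ring.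
Qed.

Definition curve_rhs (beta : F) : {poly F} := gamma *: 'X^(q + 1) + beta *: 'X.

Lemma size_curve_rhs beta : size (curve_rhs beta) = q.+2.
Proof.
have s1 : size (gamma *: 'X^(q + 1)) = q.+2 by rewrite size_scale // size_polyXn addn1.
by rewrite /curve_rhs size_polyDl s1 // (leq_ltn_trans (size_scale_leq _ _)) // size_polyX !ltnS.
Qed.

Lemma coprime_p_deg : coprime p q.+1.
Proof.
rewrite -addn1; case: l l_gt0 => // k _.
by rewrite expnS mulnC /coprime gcdnMDl gcdn1.
Qed.

(** For i < p the quotient of i (p^l + 1) by p is i p^(l-1). *)
Lemma double_genus : (2 * \sum_(i < p) (i * q.+1) %/ p = p.-1 * q)%N.
Proof.
case: l l_gt0 => // k _.
under eq_bigr => i _.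
  rewrite expnS mulnS [(i * _)%N]mulnCA addnC [(p * _)%N]mulnC divnMDl //.
  rewrite divn_small // addn0; over.
rewrite /= -big_distrl /=.
rewrite mulnA.
have -> : (2 * \sum_(i < p) i = p.-1 * p)%N.
  elim: (p) => [|d IH]; first by rewrite big_ord0.
  by rewrite big_ord_recr /= mulnDr IH; case: (d) => // e; rewrite /= -mulnDl addnC mulnC.
by rewrite -mulnA expnS.
Qed.

Lemma num_points_curve beta N : num_points (curve_C p l gamma beta) N <->
  N = (p * num_zeros p m l gamma beta).+1.
Proof.
have eC : curve_C p l gamma beta = artin_schreier p (curve_rhs beta) by [].
rewrite eC (num_points_artin_schreier charF (size_curve_rhs beta) coprime_p_deg).
rewrite (card_on_curve p_pr cardF m_gt0 alpha_prim).
suff -> : (\sum_a (trace p m (curve_rhs beta).[a] == 0%R))%N = num_zeros p m l gamma beta by [].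
apply: eq_bigr => a _; congr nat_of_bool.
by rewrite /curve_rhs /quad !hornerE addn1 (traceD p_pr cardF).
Qed.

Lemma genus_curve beta : genus (curve_C p l gamma beta) (\sum_(i < p) (i * q.+1) %/ p).
Proof. exact: (genus_artin_schreier charF (size_curve_rhs beta) coprime_p_deg). Qed.

Lemma half_m : m./2 = (l * s)%N.
Proof. by rewrite m_def mulnCA mul2n doubleK. Qed.

Lemma double_genus_sqrt :
  2 * (\sum_(i < p) (i * q.+1) %/ p)%N%:Z * (p ^ m./2)%N%:Z = p.-1%:Z * q%:Z ^+ s.+1.
Proof.
rewrite -[2]/(2%N%:Z) -PoszM double_genus half_m PoszM expnM -mulrA; congr (_ * _).
by rewrite (Posz_exp q s) -exprS.
Qed.

Lemma curve_invariantsP beta (R : nat -> nat -> Prop) :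
  (exists g N, [/\ genus (curve_C p l gamma beta) g,
     num_points (curve_C p l gamma beta) N & R g N]) <->
  R (\sum_(i < p) (i * q.+1) %/ p)%N (p * num_zeros p m l gamma beta).+1.
Proof.
split=> [[g [N [hg /num_points_curve ->]]]|RgN]; first by rewrite (genus_unique hg (genus_curve beta)).
exists (\sum_(i < p) (i * q.+1) %/ p)%N, (p * num_zeros p m l gamma beta).+1; split=> //.
  exact: genus_curve.
exact/num_points_curve.
Qed.

Lemma maximal_curveP beta : maximal_curve p m (curve_C p l gamma beta) <->
  (p * num_zeros p m l gamma beta)%N%:Z = (p ^ m)%N%:Z + p.-1%:Z * q%:Z ^+ s.+1.
Proof.
rewrite /maximal_curve curve_invariantsP double_genus_sqrt.
by move: (p.-1%:Z * _) => G; split; lia.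
Qed.

Lemma minimal_curveP beta : minimal_curve p m (curve_C p l gamma beta) <->
  (p * num_zeros p m l gamma beta)%N%:Z = (p ^ m)%N%:Z - p.-1%:Z * q%:Z ^+ s.+1.
Proof.
rewrite /minimal_curve curve_invariantsP double_genus_sqrt.
by move: (p.-1%:Z * _) => G; split; lia.
Qed.

Lemma signed_count (c N : nat) (e : int) :
  (N * p ^ (2 * l))%N = c -> (p * c)%N%:Z = (p ^ m)%N%:Z + e * q%:Z ^+ s.+1 ->
  N%:Q = p%:Q ^ (m%:Z - 2 * l%:Z - 1) + e%:~R * p%:Q ^ (m./2%:Z - l%:Z - 1).
Proof.
move=> <- eN; have p0 : p%:Q != 0 by rewrite intr_eq0; lia.
have pk0 : p%:Q ^ (2 * l%:Z + 1) != 0 by rewrite expfz_neq0.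
apply: (mulIf pk0); rewrite [RHS]mulrDl -(mulrA e%:~R) -!expfzDr //.
have -> : m%:Z - 2 * l%:Z - 1 + (2 * l%:Z + 1) = m%:Z by ring.
have -> : m./2%:Z - l%:Z - 1 + (2 * l%:Z + 1) = (l * s.+1)%N%:Z by rewrite half_m; lia.
have -> : 2 * l%:Z + 1 = (2 * l).+1%N%:Z by lia.
rewrite -!exprnP.
have := congr1 (fun z : int => z%:~R : rat) eN.
rewrite !(PoszM, Posz_exp) !(rmorphD, rmorphM, rmorphXn) /= -exprM => <-.
rewrite exprS; ring.
Qed.

Lemma num_of_zeros (P : F -> Prop) (v : nat) (e : int) :
  (forall beta, P beta <->
     (p * num_zeros p m l gamma beta)%N%:Z = (p ^ m)%N%:Z + e * q%:Z ^+ s.+1) ->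
  (p * v)%N%:Z = (p ^ m)%N%:Z + e * q%:Z ^+ s.+1 ->
  (#|[pred beta | num_zeros p m l gamma beta == v]| * p ^ (2 * l))%N = v ->
  #|[pred beta | `[< P beta >]]|%:Q =
    p%:Q ^ (m%:Z - 2 * l%:Z - 1) + e%:~R * p%:Q ^ (m./2%:Z - l%:Z - 1).
Proof.
move=> PE ve cv; rewrite -(signed_count cv ve); congr (_%:~R); congr Posz.
apply: eq_card => b; rewrite !inE; apply/asboolP/eqP => [/PE zb|zb].
  by apply/eqP; rewrite -(eqn_pmul2l p_gt0) -eqz_nat zb ve.
by apply/PE; rewrite zb.
Qed.

Lemma signed_q : (- q%:Z) ^+ s.+1 = (-1) ^+ s.+1 * q%:Z ^+ s.+1.
Proof. by rewrite -[- q%:Z]mulN1r exprMn. Qed.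

Let level0_value := level0E p_pr cardF m_gt0 alpha_prim l_gt0 m_def w0_neq0 gamma_neq0
  radical_equation.
Let level1_value := level1E p_pr cardF m_gt0 alpha_prim l_gt0 m_def w0_neq0 gamma_neq0
  radical_equation.
Let card_level0 := card_num_zeros_level0 p_pr cardF m_gt0 alpha_prim l_gt0 m_def w0_neq0
  gamma_neq0 radical_equation.
Let card_level1 := card_num_zeros_level1 p_pr cardF m_gt0 alpha_prim l_gt0 m_def w0_neq0
  gamma_neq0 radical_equation.

Lemma num_maximal_odd : odd s ->
  (num_maximal p m l gamma)%:Q = p%:Q ^ (m%:Z - 2 * l%:Z - 1)
     + (p%:Q - 1) * p%:Q ^ (m./2%:Z - l%:Z - 1).
Proof.
move=> s_odd; rewrite -[p%:Q - 1](rmorphB (intr : int -> rat) p 1) -predn_int //.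
apply: (num_of_zeros maximal_curveP _ card_level0).
by rewrite level0_value signed_q -signr_odd /= s_odd mul1r.
Qed.

Lemma num_minimal_even : ~~ odd s ->
  (num_minimal p m l gamma)%:Q = p%:Q ^ (m%:Z - 2 * l%:Z - 1)
     - (p%:Q - 1) * p%:Q ^ (m./2%:Z - l%:Z - 1).
Proof.
move=> s_even.
have minP beta : minimal_curve p m (curve_C p l gamma beta) <->
    (p * num_zeros p m l gamma beta)%N%:Z = (p ^ m)%N%:Z + (- p.-1%:Z) * q%:Z ^+ s.+1.
  by rewrite mulNr; exact: minimal_curveP.
have -> := num_of_zeros minP _ card_level0.
  by congr (_ + _); rewrite predn_int // rmorphN rmorphB /= mulNr.
by rewrite level0_value signed_q -signr_odd /= s_even mulN1r mulNr mulrN.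
Qed.

Lemma num_minimal_odd_char2 : p = 2%N -> odd s ->
  (num_minimal p m l gamma)%:Q = p%:Q ^ (m%:Z - 2 * l%:Z - 1)
     - p%:Q ^ (m./2%:Z - l%:Z - 1).
Proof.
move=> p2 s_odd.
have minP beta : minimal_curve p m (curve_C p l gamma beta) <->
    (p * num_zeros p m l gamma beta)%N%:Z = (p ^ m)%N%:Z + (- 1) * q%:Z ^+ s.+1.
  have -> : (-1 : int) = - p.-1%:Z by rewrite p2.
  by rewrite mulNr; exact: minimal_curveP.
have card_level1' : (#|[pred beta | num_zeros p m l gamma beta == level p m l gamma 1%R]| * p ^ (2 * l))%N =
    level p m l gamma 1%R by rewrite card_level1 p2 mul1n.
have -> := num_of_zeros minP _ card_level1'; first by congr (_ + _); rewrite rmorphN1 mulN1r.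
by rewrite level1_value signed_q -signr_odd /= s_odd mul1r mulN1r.
Qed.

Lemma num_maximal_even_char2 : p = 2%N -> ~~ odd s ->
  (num_maximal p m l gamma)%:Q = p%:Q ^ (m%:Z - 2 * l%:Z - 1)
     + p%:Q ^ (m./2%:Z - l%:Z - 1).
Proof.
move=> p2 s_even.
have maxP beta : maximal_curve p m (curve_C p l gamma beta) <->
    (p * num_zeros p m l gamma beta)%N%:Z = (p ^ m)%N%:Z + 1 * q%:Z ^+ s.+1.
  have -> : (1 : int) = p.-1%:Z by rewrite p2.
  exact: maximal_curveP.
have card_level1' : (#|[pred beta | num_zeros p m l gamma beta == level p m l gamma 1%R]| * p ^ (2 * l))%N =
    level p m l gamma 1%R by rewrite card_level1 p2 mul1n.
have -> := num_of_zeros maxP _ card_level1'; first by congr (_ + _); rewrite rmorph1 mul1r.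
by rewrite level1_value signed_q -signr_odd /= s_even mulN1r opprK mul1r.
Qed.

End ExtremalCurves.

(** The quotient is a sum of k odd terms. *)
Lemma odd_pred_expn_quot a k : (1 < a)%N -> odd a ->
  odd ((a ^ k).-1 %/ a.-1) = odd k.
Proof.
move=> a_gt1 a_odd; rewrite predn_exp mulKn; last by rewrite -ltnS prednK // ltnW.
elim: k => [|k IH]; first by rewrite big_ord0.
by rewrite big_ord_recr /= oddD IH oddX a_odd orbT addbT.
Qed.

Lemma half_order_prim_root (F : fieldType) (n : nat) (alpha : F) :
  (0 < n)%N -> ~~ odd n -> n.-primitive_root alpha -> alpha ^+ n./2 = -1.
Proof.
move=> n_gt0 n_even alpha_prim.
have : (alpha ^+ n./2) ^+ 2 == 1 ^+ 2.
  by rewrite -exprM muln2 even_halfK // expr1n (prim_expr_order alpha_prim).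
rewrite eqf_sqr -(prim_order_dvd alpha_prim) => /orP[dvd_half|/eqP //].
have n_half := even_halfK n_even.
have half_gt0 : (0 < n./2)%N by lia.
by have := dvdn_leq half_gt0 dvd_half; lia.
Qed.

Theorem theorem6p3 (p m l t : nat) (F : finFieldType) (alpha gamma : F)
    (p_prime : prime p) (m_gt0 : (0 < m)%N) (l_gt0 : (0 < l)%N)
    (l_dvd_m : (l %| m)%N) (ml_even : ~~ odd (m %/ l))
    (cardF : #|F| = (p ^ m)%N)
    (alpha_prim : ((p ^ m).-1).-primitive_root alpha)
    (gammaE : gamma = alpha ^+ t) :
  (odd p ->
     (~~ odd (m %/ l)./2 -> (t = 0 %[mod p ^ l + 1])%N ->
        (num_minimal p m l gamma)%:Q =
          p%:Q ^ (m%:Z - 2 * l%:Z - 1)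
          - (p%:Q - 1) * p%:Q ^ (m./2%:Z - l%:Z - 1))
     /\
     (odd (m %/ l)./2 -> (t = (p ^ l + 1)./2 %[mod p ^ l + 1])%N ->
        (num_maximal p m l gamma)%:Q =
          p%:Q ^ (m%:Z - 2 * l%:Z - 1)
          + (p%:Q - 1) * p%:Q ^ (m./2%:Z - l%:Z - 1)))
  /\
  (p = 2%N -> gamma \in power_set 2 l F ->
     (num_minimal 2 m l gamma)%:Q =
       2%:Q ^ (m%:Z - 2 * l%:Z - 1) - 2%:Q ^ (m./2%:Z - l%:Z - 1)
     /\
     (num_maximal 2 m l gamma)%:Q =
       2%:Q ^ (m%:Z - 2 * l%:Z - 1) + 2%:Q ^ (m./2%:Z - l%:Z - 1)).
Proof.
set s := (m %/ l)./2; set q := (p ^ l)%N; set n := (p ^ m).-1.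
have m_def : m = (l * (2 * s))%N.
  by rewrite /s mul2n even_halfK // mulnC divnK.
have s_gt0 : (0 < s)%N by move: m_gt0; rewrite m_def !muln_gt0 => /andP[_ /andP[]].
have p_gt1 := prime_gt1 p_prime; have p_gt0 := prime_gt0 p_prime.
have q_gt1 : (1 < q)%N by rewrite (leq_trans p_gt1) // -{1}(expn1 p) leq_exp2l.
have n_gt0 : (0 < n)%N.
  by rewrite -ltnS prednK ?expn_gt0 ?p_gt0 // -{1}(expn0 p) ltn_exp2l.
have alpha_neq0 : alpha != 0.
  apply/eqP => a0; move: (prim_expr_order alpha_prim); rewrite a0 expr0n.
  by rewrite -/n (gtn_eqF n_gt0) => /eqP; rewrite eq_sym oner_eq0.
have gamma_neq0 : gamma != 0 by rewrite gammaE expf_neq0.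
pose r := (n %/ (p ^ (2 * l)).-1)%N.
have nE : n = (r * (q.+1 * q.-1))%N.
  rewrite -pred_expn_double divnK // /n m_def mulnCA mulnA (expnM p (2 * l) s).
  exact: dvdn_pred_predX.
have odd_data : odd p -> [/\ odd q, odd r = odd s & alpha ^+ n./2 = -1].
  move=> p_odd; have q2_odd : odd (p ^ (2 * l)) by rewrite oddX p_odd orbT.
  split; first by rewrite oddX p_odd orbT.
    rewrite /r /n [in LHS]m_def mulnCA mulnA (expnM p (2 * l) s).
    by rewrite odd_pred_expn_quot // mulnC expnM (leq_trans q_gt1) // -{1}(expn1 q) leq_exp2l.
  apply: half_order_prim_root alpha_prim => //.
  by rewrite -[odd n]negbK -oddS prednK ?expn_gt0 ?p_gt0 // oddX p_odd orbT.
split=> [p_odd|p2].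
  have [q_odd r_s alpha_half] := odd_data p_odd.
  split=> [s_even t0|s_odd t0].
    have [k tE] : exists k, t = (k * q.+1)%N.
      by apply/dvdnP; rewrite /dvdn -addn1 t0 mod0n.
    (* gamma is the (q+1)-st power of alpha^k, and r is even: (alpha^(r/2))^(q^2-1) = alpha^(n/2) = -1. *)
    pose w0 := (alpha ^+ k)^-1 * alpha ^+ r./2.
    have w0_neq0 : w0 != 0 by rewrite mulf_neq0 ?invr_neq0 ?expf_neq0.
    apply: (num_minimal_even p_prime cardF alpha_prim l_gt0 s_gt0 m_def w0_neq0 gamma_neq0 _ s_even).
    rewrite -/q gammaE tE exprM -exprMn mulrA mulfV ?expf_neq0 // mul1r -!exprM.
    rewrite -[RHS]alpha_half nE; congr (_ ^+ _).
    have r_even : ~~ odd r by rewrite r_s.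
    by rewrite -[in RHS](even_halfK r_even) -doubleMl doubleK mulnA.
  have [k tE] : exists k, t = (q.+1./2 + k * q.+1)%N.
    have half_lt : ((q + 1)./2 < q + 1)%N by rewrite -divn2 ltn_Pdiv // addn1.
    exists (t %/ (q + 1))%N; rewrite -[q.+1](addn1 q).
    by rewrite {1}(divn_eq t (q + 1)) t0 (modn_small half_lt) addnC.
  (* gamma w0^(q+1) = alpha^((q+1) r / 2) with r odd, again a (q-1)-st root of alpha^(n/2) = -1. *)
  pose w0 := (alpha ^+ k)^-1 * alpha ^+ r./2.
  have w0_neq0 : w0 != 0 by rewrite mulf_neq0 ?invr_neq0 ?expf_neq0.
  apply: (num_maximal_odd p_prime cardF alpha_prim l_gt0 s_gt0 m_def w0_neq0 gamma_neq0 _ s_odd).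
  have aw : alpha ^+ k * w0 = alpha ^+ r./2 by rewrite /w0 mulrA mulfV ?mul1r ?expf_neq0.
  rewrite -/q gammaE tE exprD (exprM alpha k) -mulrA -exprMn aw -exprM -exprD -exprM -[RHS]alpha_half nE; congr (_ ^+ _).
  have qE : q.+1 = (q.+1)./2.*2 by rewrite even_halfK //= q_odd.
  have rE : r = r./2.*2.+1 by rewrite -[LHS]odd_double_half r_s s_odd add1n.
  rewrite [in RHS]rE [in RHS]qE [X in (_ + _ * X)%N]qE -doubleMl -!doubleMr doubleK.
  move: (q.+1)./2 r./2 q.-1 => a b d; rewrite -!muln2; ring.
rewrite inE => /existsP [w /andP[w_neq0 /eqP gE]].
have w0_neq0 : w^-1 != 0 by rewrite invr_neq0.
(* Here gamma w0^(q+1) = 1 = -1. *)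
have w0_rad : (gamma * w^-1 ^+ q.+1) ^+ q.-1 = -1.
  have q2E : (2 ^ l + 1 = q.+1)%N by rewrite addn1 /q p2.
  rewrite gE q2E exprVn mulfV ?expf_neq0 // expr1n.
  have ch : 2%N \in [pchar F] by rewrite -p2; apply: card_finPcharP cardF p_prime.
  by rewrite (oppr_pchar2 ch).
have [s_odd|s_even] := boolP (odd s).
  have mx := num_maximal_odd p_prime cardF alpha_prim l_gt0 s_gt0 m_def w0_neq0 gamma_neq0 w0_rad s_odd.
  have mn := num_minimal_odd_char2 p_prime cardF alpha_prim l_gt0 s_gt0 m_def w0_neq0 gamma_neq0 w0_rad p2 s_odd.
  by move: mx mn; rewrite p2 => -> ->; split=> //; rewrite -[2%:~R - 1]/(1 : rat) mul1r.
have mn := num_minimal_even p_prime cardF alpha_prim l_gt0 s_gt0 m_def w0_neq0 gamma_neq0 w0_rad s_even.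
have mx := num_maximal_even_char2 p_prime cardF alpha_prim l_gt0 s_gt0 m_def w0_neq0 gamma_neq0 w0_rad p2 s_even.
by move: mx mn; rewrite p2 => -> ->; split=> //; rewrite -[2%:~R - 1]/(1 : rat) mul1r.
Qed.
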